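(* Under the standing setup below, $A^{P(\sigma)}\equiv 1\pmod{\pi^{2(p-1)}}$, where $A^{P(\sigma)}=\prod_{i=0}^{p-2}\sigma^i(A)^{v^{-i}}$.
   Context: Let $p$ be an odd prime, $\zeta_p$ a primitive $p$-th root of unity, $K_p=\mathbb Q(\zeta_p)$ with ring of integers $\mathbb Z[\zeta_p]$, $K_p^+$ its maximal totally real subfield, $\lambda=\zeta_p-1$, $\pi=\lambda\mathbb Z[\zeta_p]$; for $x,y\in K_p$, $x\equiv y\pmod{\pi^k}$ means the $\pi$-adic valuation of $x-y$ is at least $k$, and $\pi^k\,\|\,x$ means $x\in\pi^k$, $x\notin\pi^{k+1}$. Fix a primitive root $v$ modulo $p$; for $n\in\mathbb Z$, $v^n$ denotes the integer in $\{1,\dots,p-1\}$ congruent to $v^n$ modulo $p$ (for $n<0$ using the inverse of $v$ mod $p$). Let $\sigma\in G_p=\mathrm{Gal}(K_p/\mathbb Q)$ be $\zeta_p\mapsto\zeta_p^v$ and $P(\sigma)=\sum_{i=0}^{p-2}v^{-i}\sigma^i\in\mathbb Z[G_p]$. Standing setup: assume $p$ is irregular and $p$ does not divide the class number of $K_p^+$. Let $C_p$ be the $p$-Sylow subgroup of the ideal class group of $K_p$, $m$ an integer with $1\le m\le\frac{p-3}{2}$, $\mu=v^{2m+1}$, and $\Gamma\subset C_p$ a subgroup of order $p$ annihilated by $\sigma-\mu$. Let $\mathbf q$ be a non-principal prime ideal of $\mathbb Z[\zeta_p]$ of inertial degree $1$ (so $N\mathbf q=q\equiv1\pmod p$) whose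 class lies in $\Gamma$, and let $A\in\mathbb Z[\zeta_p]$ with $A\mathbb Z[\zeta_p]=\mathbf q^p$, $\sigma(A)=A^{\mu}\alpha^p$ for some $\alpha\in K_p$, $\pi^{2m+1}\,\|\,A-1$, and $A\overline A=D^p$ for some $D$ in the ring of integers of $K_p^+$. *)

(* Defs.v *)
From mathcomp Require Import all_boot all_order all_algebra all_field.
Set Implicit Arguments.
Unset Strict Implicit.
Unset Printing Implicit Defensive.
Import Order.TTheory GRing.Theory Num.Theory.
Local Open Scope ring_scope.

Definition cset := algC -> Prop.

Definition Zring (z : algC) : cset :=
  fun x => exists c : seq int, x = \sum_(i < size c) (c`_i)%:~R * z ^+ i.

Definition Qfield (z : algC) : cset :=
  fun x => exists c : seq rat, x = \sum_(i < size c) ratr (c`_i) * z ^+ i.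

Definition Qfield_plus (z : algC) : cset := fun x => Qfield z x /\ x^* = x.
Definition Oplus (z : algC) : cset := fun x => Qfield_plus z x /\ x \in Aint.

Definition seteq (I J : cset) := forall x, I x <-> J x.

Definition is_ideal (R I : cset) : Prop :=
  [/\ (forall x, I x -> R x), I 0,
      (forall x y, I x -> I y -> I (x + y)) &
      (forall r x, R r -> I x -> I (r * x))].

Definition nonzero_ideal (R I : cset) : Prop :=
  is_ideal R I /\ exists x, I x /\ x != 0.

Definition principal (R : cset) (a : algC) : cset :=
  fun x => exists r, R r /\ x = a * r.

Definition is_principal (R I : cset) : Prop :=
  exists a, R a /\ seteq I (principal R a).

Definition ideal_mul (I J : cset) : cset :=
  fun x => exists s : seq (algC * algC),
    (forall u, u \in s -> I u.1 /\ J u.2) /\ x = \sum_(u <- s) u.1 * u.2.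

Definition ideal_pow (R I : cset) (n : nat) : cset :=
  iter n (ideal_mul I) (principal R 1).

Definition scale_set (a : algC) (I : cset) : cset :=
  fun x => exists y, I y /\ x = a * y.

Definition ideal_equiv (R I J : cset) : Prop :=
  exists a b, [/\ R a, R b, a != 0, b != 0 & seteq (scale_set a I) (scale_set b J)].

Definition prime_ideal (R I : cset) : Prop :=
  [/\ nonzero_ideal R I, ~ I 1 &
      forall x y, R x -> R y -> I (x * y) -> I x \/ I y].

(* residue field of I is F_l for a rational prime l: inertial degree 1 *)
Definition inertial_degree_one (R I : cset) : Prop :=
  exists l : nat, [/\ prime l, I l%:R &
                      forall x, R x -> exists n : int, I (x - n%:~R)].

Definition image_set (f : algC -> algC) (I : cset) : cset :=
  fun x => exists y, I y /\ x = f y.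

Definition class_number (R : cset) (h : nat) : Prop :=
  exists s : seq cset,
    [/\ size s = h,
        (forall i, (i < h)%N -> nonzero_ideal R (nth (fun _ => False) s i)),
        (forall i j, (i < h)%N -> (j < h)%N -> i <> j ->
            ~ ideal_equiv R (nth (fun _ => False) s i) (nth (fun _ => False) s j)) &
        (forall I, nonzero_ideal R I ->
            exists2 i, (i < h)%N & ideal_equiv R I (nth (fun _ => False) s i))].

(* G (a class-saturated predicate on nonzero ideals of R) represents a
   subgroup of the p-Sylow subgroup of the class group of R, of order p,
   annihilated by sigma - mu. *)
Definition class_subgroup_order_p_annihilated (R : cset) (p : nat)
    (sigma : algC -> algC) (mu : nat) (G : cset -> Prop) : Prop :=
  (forall I, G I -> nonzero_ideal R I) /\
  (forall I J, G I -> nonzero_ideal R J -> ideal_equiv R I J -> G J) /\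
  G (principal R 1) /\
  (forall I J, G I -> G J -> G (ideal_mul I J)) /\
  (forall I, G I -> exists2 J, G J & is_principal R (ideal_mul I J)) /\
  (forall I, G I -> exists k, is_principal R (ideal_pow R I (p ^ k))) /\
  (exists s : seq cset,
     [/\ size s = p,
         (forall i, (i < p)%N -> G (nth (fun _ => False) s i)),
         (forall i j, (i < p)%N -> (j < p)%N -> i <> j ->
            ~ ideal_equiv R (nth (fun _ => False) s i) (nth (fun _ => False) s j)) &
         (forall I, G I ->
            exists2 i, (i < p)%N & ideal_equiv R I (nth (fun _ => False) s i))]) /\
  (forall I, G I -> ideal_equiv R (image_set sigma I) (ideal_pow R I mu)).

Definition primitive_root_mod (p v : nat) : bool :=
  (v %% p != 0)%N && [forall k : 'I_p.-1, (0 < k)%N ==> (v ^ k %% p != 1)%N].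

(* x = y mod pi^k, with pi = (z - 1) Z[z]; for x, y in Z[z] *)
Definition cong_pi (z : algC) (k : nat) (x y : algC) : Prop :=
  exists w, Zring z w /\ x - y = (z - 1) ^+ k * w.

(* Main.v *)
Require Import Defs.
From mathcomp Require Import all_boot all_order all_algebra all_field.
From mathcomp Require Import ring zify.
Import Order.TTheory GRing.Theory Num.Theory.
Local Open Scope ring_scope.

(** Choose an algebraic integer a with a^p = A.  Among all algebraic integers,
    a divides every element of q, so the conjugates of a replace those of q and
    no ideal factorization is needed.  If q lies above the rational prime l, the
    Gauss sum tau of the p-th power residue character modulo q satisfies
    Stickelberger's divisibility: tau^p is divisible by every
    sigma^i(a)^(v^(-i)), hence by their product b, because distinct conjugates
    of a are coprime; and b^p = A^P(sigma) =: B.  So eta = (- tau^p)^p / B is an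
    algebraic integer.  All conjugates of tau have absolute value l^(1/2).  The
    relation A * A^* = D^p forces N(A) = l^p up to sign, whence all conjugates
    of B have absolute value l^(p^2/2); so eta has absolute value 1 at every
    place.  Both B and - tau^p are 1 modulo lam^2, where lam = z - 1, and a
    norm estimate on eta^(p^p) - 1 then gives eta = 1.  Finally tau = -1 modulo
    lam, so B = (- tau)^(p^2) is 1 modulo lam^(2p-1). *)

Set Implicit Arguments.
Unset Strict Implicit.

(** * Divisibility among algebraic integers *)

(** Divisibility in the ring of all algebraic integers rather than in Z[z], so that p-th roots of
    elements may serve as divisors; the divisor comes first. *)
Definition adv (e x : algC) : Prop := exists2 u, u \in Aint & x = u * e.

(** If P is monic with integer coefficients and kills x^n, then P(X^n) is monic, integral and kills
    x. *)
Lemma Aint_root_exp n (x : algC) : (0 < n)%N -> x ^+ n \in Aint -> x \in Aint.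
Proof.
move=> n0 Ax; have [P [Pm PZ] Pr] :
    exists2 P, P \is monic /\ P \is a polyOver Num.int & root P (x ^+ n).
  exists (minCpoly (x ^+ n)); last exact: root_minCpoly.
  by split; [exact: minCpoly_monic | exact: Ax].
have sX : size ('X^n : {poly algC}) = n.+1 by rewrite size_polyXn.
apply: (@root_monic_Aint (P \Po 'X^n)).
- by rewrite rootE horner_comp hornerXn -rootE.
- rewrite monicE lead_coef_comp ?sX ?ltnS //.
  by rewrite (monicP Pm) lead_coefXn expr1n mulr1.
- apply/polyOver_comp => //; exact: rpredX (polyOverX _).
Qed.

Lemma adv0 e : adv e 0.
Proof. by exists 0; [rewrite rpred0 | rewrite mul0r]. Qed.

Lemma advv e : adv e e.
Proof. by exists 1; [rewrite rpred1 | rewrite mul1r]. Qed.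

Lemma advD e x y : adv e x -> adv e y -> adv e (x + y).
Proof. by move=> [u uA ->] [v vA ->]; exists (u + v); [rewrite rpredD | rewrite mulrDl]. Qed.

Lemma advN e x : adv e x -> adv e (- x).
Proof. by move=> [u uA ->]; exists (- u); [rewrite rpredN | rewrite mulNr]. Qed.

Lemma advB e x y : adv e x -> adv e y -> adv e (x - y).
Proof. by move=> ex ey; apply/advD/advN. Qed.

Lemma advMl e u x : u \in Aint -> adv e x -> adv e (u * x).
Proof. by move=> uA [v vA ->]; exists (u * v); [rewrite rpredM | rewrite mulrA]. Qed.

Lemma advMr e u x : u \in Aint -> adv e x -> adv e (x * u).
Proof. by rewrite mulrC; apply: advMl. Qed.

Lemma adv_trans y x t : adv x y -> adv y t -> adv x t.
Proof. by move=> xy [u uA ->]; apply: advMl. Qed.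

Lemma advM e f x y : adv e x -> adv f y -> adv (e * f) (x * y).
Proof.
by move=> [u uA ->] [v vA ->]; exists (u * v); [rewrite rpredM | rewrite mulrACA].
Qed.

Lemma advX e x n : adv e x -> adv (e ^+ n) (x ^+ n).
Proof. by move=> [u uA ->]; exists (u ^+ n); [rewrite rpredX | rewrite exprMn]. Qed.

Lemma adv_prod (I : Type) (s : seq I) (P : pred I) (E F : I -> algC) :
  (forall i, P i -> adv (E i) (F i)) ->
  adv (\prod_(i <- s | P i) E i) (\prod_(i <- s | P i) F i).
Proof.
move=> H; apply: (big_ind2 adv) => //; first exact: advv.
by move=> x1 x2 y1 y2; apply: advM.
Qed.

Lemma adv_sum (I : Type) (s : seq I) (P : pred I) e (F : I -> algC) :
  (forall i, P i -> adv e (F i)) -> adv e (\sum_(i <- s | P i) F i).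
Proof. by move=> H; apply: big_ind => //; [exact: adv0 | apply: advD]. Qed.

Lemma adv_prod_factor {I : finType} (P : pred I) (F : I -> algC) i :
  P i -> (forall j, F j \in Aint) -> adv (F i) (\prod_(j | P j) F j).
Proof.
move=> Pi FA; rewrite (bigD1 i) //=; apply: advMr; last exact: advv.
by rewrite rpred_prod.
Qed.

Lemma adv_exp_le e m n : e \in Aint -> (m <= n)%N -> adv (e ^+ m) (e ^+ n).
Proof.
by move=> eA mn; exists (e ^+ (n - m)); rewrite ?rpredX // -exprD subnK.
Qed.

(** The algebraic integers are integrally closed: (x / c)^n integral forces x / c integral. This
    replaces the extraction of p-th roots of ideals. *)
Lemma adv_root n c x : (0 < n)%N -> adv (c ^+ n) (x ^+ n) -> adv c x.
Proof.
move=> n0 [u uA xE]; have [c0|c0] := eqVneq c 0.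
  move/eqP: xE; rewrite c0 expr0n eqn0Ngt n0 mulr0 expf_eq0 n0 /= => /eqP->.
  exact: adv0.
exists (x / c); last by rewrite divfK.
apply: (@Aint_root_exp n) => //.
by rewrite exprMn xE exprVn mulfK // expf_neq0.
Qed.

Lemma adv_subX e x y n : x \in Aint -> y \in Aint -> adv e (x - y) ->
  adv e (x ^+ n - y ^+ n).
Proof.
move=> xA yA exy; rewrite subrXX; apply: advMr => //.
by rewrite rpred_sum // => i _; rewrite rpredM ?rpredX.
Qed.

Lemma adv_subM e x y x' y' : x \in Aint -> y' \in Aint ->
  adv e (x - x') -> adv e (y - y') -> adv e (x * y - x' * y').
Proof.
move=> xA yA ex ey.
have -> : x * y - x' * y' = x * (y - y') + (x - x') * y' by ring.
by apply: advD; [apply: advMl | apply: advMr].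
Qed.

Lemma Aint_rmorph (f : {rmorphism algC -> algC}) x :
  x \in Aint -> f x \in Aint.
Proof. by rewrite Aint_aut. Qed.

Lemma adv_rmorph (f : {rmorphism algC -> algC}) e x :
  adv e x -> adv (f e) (f x).
Proof. by move=> [u uA ->]; exists (f u); rewrite ?Aint_aut // rmorphM. Qed.

(** The way back to Z: a rational algebraic integer is an integer. *)
Lemma adv_int (m : nat) (n : int) : adv m%:R n%:~R -> (m %| `|n|)%N.
Proof.
case: m => [|m] [u uA nE].
  by move/eqP: nE; rewrite mulr0 intr_eq0 => /eqP->.
have m0 : m.+1%:R != 0 :> algC by rewrite pnatr_eq0.
have uE : u = n%:~R / m.+1%:R by rewrite nE mulfK.
have /intrP[k kE] : u \in Num.int.
  apply: Cint_rat_Aint => //; rewrite uE.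
  by rewrite rpred_div // ?rpred_int ?rpred_nat.
have {}nE : n = k * m.+1%:Z.
  by apply/eqP; rewrite -(eqr_int algC) nE kE rmorphM.
by rewrite nE abszM dvdn_mull.
Qed.

(** * Comaximality in the ring of algebraic integers *)

Definition acop (x y : algC) : Prop :=
  exists u v, [/\ u \in Aint, v \in Aint & u * x + v * y = 1].

Lemma acopC x y : acop x y -> acop y x.
Proof. by move=> [u [v [uA vA E]]]; exists v, u; rewrite addrC. Qed.

Lemma acop1 x : acop x 1.
Proof. by exists 0, 1; rewrite rpred0 rpred1 mul0r mulr1 add0r. Qed.

Lemma acopM x y t : x \in Aint -> y \in Aint -> t \in Aint ->
  acop x y -> acop x t -> acop x (y * t).
Proof.
move=> xA yA tA [u [v [uA vA E]]] [u' [v' [uA' vA' E']]].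
exists (u * u' * x + u * v' * t + v * u' * y), (v * v'); split.
- by rewrite !rpredD ?rpredM.
- by rewrite rpredM.
- by rewrite -[1]mulr1 -{1}E -E'; ring.
Qed.

Lemma acopX x y n : x \in Aint -> y \in Aint -> acop x y -> acop x (y ^+ n).
Proof.
move=> xA yA xy; elim: n => [|n IH]; first by rewrite expr0; apply: acop1.
by rewrite exprS; apply: acopM => //; rewrite rpredX.
Qed.

Lemma acop_prod (I : Type) (s : seq I) (P : pred I) x (F : I -> algC) :
  x \in Aint -> (forall i, P i -> F i \in Aint /\ acop x (F i)) ->
  acop x (\prod_(i <- s | P i) F i).
Proof.
move=> xA H.
suff [] : \prod_(i <- s | P i) F i \in Aint /\ acop x (\prod_(i <- s | P i) F i).
  by [].
apply: (big_ind (fun y => y \in Aint /\ acop x y)) => //.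
  by rewrite rpred1; split => //; apply: acop1.
by move=> y t [yA xy] [tA xt]; rewrite rpredM //; split => //; apply: acopM.
Qed.

(** Multiply u x + v y = 1 by t: each summand on the left is then a multiple of x y. *)
Lemma acop_adv x y t : acop x y -> adv x t -> adv y t -> adv (x * y) t.
Proof.
move=> [u [v [uA vA E]]] [r rA rE] [s sA sE].
exists (u * s + v * r); first by rewrite rpredD ?rpredM.
by rewrite -[LHS]mulr1 -E mulrDr {1}sE rE; ring.
Qed.

Lemma acop_prod_adv n (F : 'I_n -> algC) t :
  (forall i, F i \in Aint) -> (forall i j, i != j -> acop (F i) (F j)) ->
  (forall i, adv (F i) t) -> t \in Aint -> adv (\prod_(i < n) F i) t.
Proof.
elim: n F => [|n IH] F FA Fc Ft tA.
  by rewrite big_ord0; exists t; rewrite ?mulr1.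
rewrite big_ord_recl; apply: acop_adv => //.
  by apply: acop_prod => // i _; split => //; apply: Fc; apply: neq_lift.
apply: IH => // i j ij; apply: Fc; apply: contra ij => /eqP/lift_inj->.
exact: eqxx.
Qed.

Lemma acop_nat x y (m n : nat) : coprime m n -> (0 < m)%N ->
  adv x m%:R -> adv y n%:R -> acop x y.
Proof.
move=> mn m0 [r rA rE] [s sA sE].
case: (egcdnP n m0) => a b E _; rewrite (eqP mn) in E.
exists (a%:R * r), (- b%:R * s); split.
- by rewrite rpredM ?rpred_nat.
- by rewrite rpredM ?rpredN ?rpred_nat.
- by rewrite -!mulrA -rE -sE mulNr -!natrM E natrD addrAC subrr add0r.
Qed.

Lemma adv_coprime e (m n : nat) : coprime m n -> (0 < m)%N ->
  adv e m%:R -> adv e n%:R -> adv e 1.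
Proof.
move=> mn m0 em en.
have [u [v [uA vA <-]]] := @acop_nat e e m n mn m0 em en.
by apply: advD; apply: advMl => //; apply: advv.
Qed.

(** * Arithmetic of the cyclotomic field *)

(** Passing from coefficient sequences to values of polynomials lets Z[z] and Q(z) inherit their
    closure properties from polynomial arithmetic. *)
Lemma polyimgP (R : nzRingType) (f : {rmorphism R -> algC}) (z x : algC) :
  (exists c : seq R, x = \sum_(i < size c) f c`_i * z ^+ i) <->
  (exists P : {poly R}, x = (map_poly f P).[z]).
Proof.
have sz (P : {poly R}) : (size (map_poly f P) <= size P)%N by apply: size_poly.
split=> [[c ->]|[P ->]].
  exists (Poly c).
  rewrite (horner_coef_wide z (leq_trans (sz _) (size_Poly c))).
  by apply: eq_bigr => i _; rewrite coef_map coef_Poly.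
exists P; rewrite (horner_coef_wide z (sz P)).
by apply: eq_bigr => i _; rewrite coef_map.
Qed.

Lemma ZringP z x : Zring z x <-> exists P : {poly int}, x = (map_poly intr P).[z].
Proof. exact: (@polyimgP int intr). Qed.

Lemma QfieldP z x : Qfield z x <-> exists P : {poly rat}, x = (map_poly ratr P).[z].
Proof. exact: (@polyimgP rat ratr). Qed.

Lemma ZringD z x y : Zring z x -> Zring z y -> Zring z (x + y).
Proof.
move=> /ZringP[P ->] /ZringP[Q ->]; apply/ZringP; exists (P + Q).
by rewrite rmorphD hornerD.
Qed.

Lemma ZringM z x y : Zring z x -> Zring z y -> Zring z (x * y).
Proof.
move=> /ZringP[P ->] /ZringP[Q ->]; apply/ZringP; exists (P * Q).
by rewrite rmorphM hornerM.
Qed.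

Lemma Zring_int z (n : int) : Zring z n%:~R.
Proof. by apply/ZringP; exists n%:P; rewrite map_polyC hornerC. Qed.

Lemma Zring_nat z (n : nat) : Zring z n%:R.
Proof. exact: (Zring_int z n). Qed.

Lemma ZringN z x : Zring z x -> Zring z (- x).
Proof.
by move=> /ZringP[P ->]; apply/ZringP; exists (- P); rewrite rmorphN hornerN.
Qed.

Lemma Zring1 z : Zring z 1.
Proof. exact: (Zring_nat z 1). Qed.

Lemma Zring_gen z : Zring z z.
Proof. by apply/ZringP; exists 'X; rewrite map_polyX hornerX. Qed.

Lemma ZringX z x n : Zring z x -> Zring z (x ^+ n).
Proof.
move=> xZ; elim: n => [|n IH]; first exact: Zring1.
by rewrite exprS; apply: ZringM.
Qed.

Lemma Zring_prod z (I : Type) (s : seq I) (P : pred I) (F : I -> algC) :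
  (forall i, P i -> Zring z (F i)) -> Zring z (\prod_(i <- s | P i) F i).
Proof. by move=> H; apply: big_ind => //; [exact: Zring1 | apply: ZringM]. Qed.

Lemma Zring_sum z (I : Type) (s : seq I) (P : pred I) (F : I -> algC) :
  (forall i, P i -> Zring z (F i)) -> Zring z (\sum_(i <- s | P i) F i).
Proof.
by move=> H; apply: big_ind => //; [exact: (Zring_int z 0) | apply: ZringD].
Qed.

Lemma Zring_Aint z x : z \in Aint -> Zring z x -> x \in Aint.
Proof.
move=> root_Aint [c ->]; rewrite rpred_sum // => i _.
by rewrite rpredM ?rpredX ?Aint_int.
Qed.

Lemma Zring_Qfield z x : Zring z x -> Qfield z x.
Proof.
move=> /ZringP[P ->]; apply/QfieldP; exists (map_poly intr P).
congr _.[z]; apply/polyP => i; rewrite !coef_map /=.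
by rewrite ratr_int.
Qed.

Lemma QfieldD z x y : Qfield z x -> Qfield z y -> Qfield z (x + y).
Proof.
move=> /QfieldP[P ->] /QfieldP[Q ->]; apply/QfieldP; exists (P + Q).
by rewrite rmorphD hornerD.
Qed.

Lemma QfieldM z x y : Qfield z x -> Qfield z y -> Qfield z (x * y).
Proof.
move=> /QfieldP[P ->] /QfieldP[Q ->]; apply/QfieldP; exists (P * Q).
by rewrite rmorphM hornerM.
Qed.

Lemma Qfield_Crat z x : x \in Crat -> Qfield z x.
Proof.
move=> /CratP[r ->]; apply/QfieldP; exists r%:P.
by rewrite map_polyC hornerC.
Qed.

Lemma Qfield1 z : Qfield z 1.
Proof. by apply: Qfield_Crat; rewrite rpred1. Qed.

Lemma QfieldB z x y : Qfield z x -> Qfield z y -> Qfield z (x - y).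
Proof.
move=> xQ yQ; apply: QfieldD => //; rewrite -mulN1r; apply: QfieldM => //.
by apply: Qfield_Crat; rewrite rpredN rpred1.
Qed.

Lemma QfieldX z x n : Qfield z x -> Qfield z (x ^+ n).
Proof.
move=> xQ; elim: n => [|n IH]; first exact: Qfield1.
by rewrite exprS; apply: QfieldM.
Qed.

Lemma Qfield_prod z (I : Type) (s : seq I) (P : pred I) (F : I -> algC) :
  (forall i, P i -> Qfield z (F i)) -> Qfield z (\prod_(i <- s | P i) F i).
Proof. by move=> H; apply: big_ind => //; [exact: Qfield1 | apply: QfieldM]. Qed.

Lemma rmorph_ratr (f : {rmorphism algC -> algC}) (r : rat) :
  f (ratr r) = ratr r.
Proof. exact: fmorph_rat. Qed.

(** A morphism on Q(z) is determined by the image of z. Powers of [sigma] and complex conjugation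
    are compared in this way. *)
Lemma rmorph_Qfield (f g : {rmorphism algC -> algC}) z x :
  f z = g z -> Qfield z x -> f x = g x.
Proof.
move=> fgz [c ->]; rewrite !rmorph_sum /=; apply: eq_bigr => i _.
by rewrite !(rmorphM _ (ratr _)) !rmorph_ratr !rmorphXn fgz.
Qed.

Lemma Crat_rmorph (f : {rmorphism algC -> algC}) x : x \in Crat -> f x = x.
Proof. by move=> /CratP[r ->]; rewrite rmorph_ratr. Qed.

Lemma rmorph_Zring (f : {rmorphism algC -> algC}) z x k :
  f z = z ^+ k -> Zring z x -> Zring z (f x).
Proof.
move=> fz [c ->]; rewrite rmorph_sum; apply: Zring_sum => i _.
rewrite rmorphM rmorph_int rmorphXn fz.
by apply/ZringM/ZringX/ZringX/Zring_gen; apply: Zring_int.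
Qed.

Lemma rmorph_Qfield_closed (f : {rmorphism algC -> algC}) z x k :
  f z = z ^+ k -> Qfield z x -> Qfield z (f x).
Proof.
move=> fz [c ->]; rewrite rmorph_sum.
apply: big_ind => [|u w uQ wQ|i _]; first by apply: Qfield_Crat; rewrite rpred0.
  exact: QfieldD.
rewrite rmorphM rmorph_ratr rmorphXn fz; apply: QfieldM.
  by apply: Qfield_Crat; apply/CratP; exists c`_i.
by apply/QfieldX/QfieldX/Zring_Qfield/Zring_gen.
Qed.

(** Bundled as a ring morphism, so that the general facts on morphisms apply to every power of
    [sigma]. *)
Fixpoint iterm (f : {rmorphism algC -> algC}) n : {rmorphism algC -> algC} :=
  if n is m.+1 then (f \o iterm f m)%FUN : {rmorphism algC -> algC} else idfun.

Lemma itermE f n x : iterm f n x = iter n f x.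
Proof. by elim: n => //= n ->. Qed.

Lemma itermD f m n x : iterm f (m + n) x = iterm f m (iterm f n x).
Proof. by rewrite !itermE iterD. Qed.

Lemma modn_mulI a d m n : coprime a d ->
  (a * m = a * n %[mod d])%N -> (m = n %[mod d])%N.
Proof.
wlog gal_nm : m n / (n <= m)%N => [H ad E|].
  by have [/H|/ltnW/H] := leqP n m; [apply | move=> {}H; apply/esym/H].
move=> ad /eqP; rewrite eqn_mod_dvd ?leq_mul2l ?gal_nm ?orbT // -mulnBr.
by rewrite Gauss_dvdr 1?coprime_sym // -eqn_mod_dvd // => /eqP.
Qed.

(** * The Galois action on Q(z) *)

Section Cyclotomic.

Variables (p : nat) (z : algC) (v : nat) (sigma : {rmorphism algC -> algC}).
Hypotheses (p_pr : prime p) (p_odd : odd p) (z_prim : p.-primitive_root z).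
Hypotheses (v_prim : primitive_root_mod p v) (sigmaz : sigma z = z ^+ v).

Let p_gt0 := prime_gt0 p_pr.
Let p_gt1 := prime_gt1 p_pr.

Lemma root_Aint : z \in Aint. Proof. exact: Aint_prim_root z_prim. Qed.

Lemma prim_root_neq0 : z != 0.
Proof.
apply/eqP => z0; have := prim_expr_order z_prim.
by rewrite z0 expr0n gtn_eqF // => /eqP; rewrite eq_sym oner_eq0.
Qed.

Lemma conj_z : z^* = z ^+ p.-1.
Proof.
apply: (mulfI prim_root_neq0); rewrite -exprS prednK // (prim_expr_order z_prim).
rewrite -normCK; have : `|z| ^+ p == 1.
  by rewrite -normrX (prim_expr_order z_prim) normr1.
by rewrite pexpr_eq1 // => /eqP->; rewrite expr1n.
Qed.

Lemma coprime_v : coprime v p.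
Proof.
case/andP: v_prim => v0 _; by rewrite coprime_sym prime_coprime.
Qed.

Lemma v_exp_pred : (v ^ p.-1 = 1 %[mod p])%N.
Proof.
by apply: (modn_mulI coprime_v); rewrite -expnS prednK // muln1 fermat_little.
Qed.

Lemma v_exp_neq1 k : (0 < k < p.-1)%N -> (v ^ k %% p != 1)%N.
Proof.
case/andP=> k0 kp; case/andP: v_prim => _ /forallP/(_ (Ordinal kp)) /=.
by rewrite k0.
Qed.

Lemma v_exp_inj i j : (i < p.-1)%N -> (j < p.-1)%N ->
  (v ^ i = v ^ j %[mod p])%N -> i = j.
Proof.
wlog ij : i j / (i < j)%N => [H ip jp E|].
  by case: (ltngtP i j) => // ij; [apply: H | apply/esym/H].
move=> ip jp E; exfalso.
have jE : j = (i + (j - i))%N by rewrite subnKC // ltnW.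
have : (v ^ (j - i) = 1 %[mod p])%N.
  apply: (@modn_mulI (v ^ i)); first by rewrite coprimeXl // coprime_v.
  by rewrite -expnD -jE muln1.
rewrite (modn_small p_gt1) => E1.
have /v_exp_neq1 : (0 < j - i < p.-1)%N by lia.
by rewrite E1 eqxx.
Qed.

(** The p - 1 powers of v are distinct nonzero residues, hence all of them; sums and products over
    the Galois group become sums and products over exponents 1 to p - 1. *)
Lemma v_exp_perm :
  perm_eq [seq (v ^ i %% p)%N | i <- iota 0 p.-1] (iota 1 p.-1).
Proof.
have Hu : uniq [seq (v ^ i %% p)%N | i <- iota 0 p.-1].
  rewrite map_inj_in_uniq ?iota_uniq // => i j.
  by rewrite !mem_iota !add0n /=; apply: v_exp_inj.
apply: uniq_perm; rewrite ?iota_uniq //.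
apply: (uniq_min_size Hu _ _).2; last by rewrite size_map !size_iota.
move=> x /mapP[i _ ->]; rewrite mem_iota add1n prednK // ltn_pmod // andbT lt0n.
by rewrite -/(dvdn _ _) -prime_coprime // coprime_sym coprimeXl // coprime_v.
Qed.

Lemma big_v_exp (R : Type) (idx : R) (op : Monoid.com_law idx) (F : nat -> R) :
  \big[op/idx]_(i < p.-1) F (v ^ i %% p)%N = \big[op/idx]_(1 <= k < p) F k.
Proof.
rewrite -(big_mkord xpredT (fun i => F (v ^ i %% p)%N)) /index_iota !subn0 subn1.
by rewrite -(perm_big _ v_exp_perm) big_map.
Qed.

Notation s := (iterm sigma).

Lemma iterm_root i : s i z = z ^+ (v ^ i).
Proof.
elim: i => [|i IH] /=; first by rewrite expn0 expr1.
by rewrite IH rmorphXn sigmaz -exprM expnSr mulnC.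
Qed.

Lemma iterm_root_mod i : s i z = z ^+ (v ^ i %% p).
Proof. by rewrite iterm_root prim_expr_mod. Qed.

Lemma iterm_Zring i x : Zring z x -> Zring z (s i x).
Proof. exact: rmorph_Zring (iterm_root i). Qed.

Lemma iterm_Qfield i x : Qfield z x -> Qfield z (s i x).
Proof. exact: rmorph_Qfield_closed (iterm_root i). Qed.

Lemma iterm_pred x : Qfield z x -> s p.-1 x = x.
Proof.
apply: (@rmorph_Qfield _ idfun); rewrite iterm_root_mod v_exp_pred.
by rewrite modn_small // expr1.
Qed.

Lemma conj_Qfield x : Qfield z x -> Qfield z x^*.
Proof. exact: (@rmorph_Qfield_closed Num.conj _ _ _ conj_z). Qed.

Lemma conj_iterm i x : Qfield z x -> (s i x)^* = s i x^*.
Proof.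
apply: (@rmorph_Qfield (Num.conj \o s i)%FUN (s i \o Num.conj)%FUN) => /=.
by rewrite conj_z iterm_root !rmorphXn /= conj_z iterm_root -!exprM mulnC.
Qed.

(** The power is a square root of 1 modulo p and, v being a primitive root, not 1 itself; hence it
    is -1. *)
Lemma v_exp_half : (v ^ p./2 = p.-1 %[mod p])%N.
Proof.
have E : ((v ^ p./2) ^ 2 = 1 %[mod p])%N.
  by rewrite -expnM -v_exp_pred; congr (_ ^ _ %% _)%N; lia.
have v1 : (0 < v ^ p./2)%N.
  rewrite expn_gt0; case: v coprime_v => //= /eqP.
  by rewrite gcd0n => p1; have := p_gt1; rewrite p1.
have : (p %| (v ^ p./2 - 1) * (v ^ p./2 + 1))%N.
  by rewrite -subn_sqr -eqn_mod_dvd ?exp1n ?E ?eqxx ?sqrn_gt0 // expn_gt0 v1.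
have hp : (0 < p./2 < p.-1)%N by have := odd_double_half p; lia.
rewrite Euclid_dvdM // => /orP[]; rewrite -?eqn_mod_dvd //.
  by rewrite [(1 %% p)%N]modn_small // (negPf (v_exp_neq1 hp)).
move=> pv; apply/eqP; rewrite -(eqn_modDr 1) addn1 addn1 prednK // modnn.
by rewrite -addn1.
Qed.

Lemma iterm_half x : Qfield z x -> s p./2 x = x^*.
Proof.
apply: (@rmorph_Qfield _ Num.conj) => /=; rewrite conj_z iterm_root.
by rewrite -(prim_expr_mod z_prim) v_exp_half prim_expr_mod.
Qed.

(** The exponents v^i run through 1 to p - 1, and the full geometric sum of z^j vanishes when z^j is
    not 1. *)
Lemma sum_z_exp j : \sum_(i < p.-1) z ^+ (j * v ^ i) =
  if (p %| j)%N then p.-1%:R else -1.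
Proof.
have -> : \sum_(i < p.-1) z ^+ (j * v ^ i) =
    \sum_(i < p.-1) z ^+ (j * (v ^ i %% p)).
  apply: eq_bigr => i _; rewrite -(prim_expr_mod z_prim) -modnMmr.
  by rewrite (prim_expr_mod z_prim).
rewrite (big_v_exp _ (fun k => z ^+ (j * k))).
have [pj|pj] := boolP (p %| j)%N.
  rewrite (eq_bigr (fun=> 1)) => [|i _].
    by rewrite sumr_const_nat subn1.
  by apply/eqP; rewrite -(prim_order_dvd z_prim) dvdn_mulr.
have zj1 : z ^+ j != 1 by rewrite -(prim_order_dvd z_prim).
have : (z ^+ j - 1) * \sum_(0 <= k < p) z ^+ (j * k) = 0.
  rewrite big_mkord; under eq_bigr do rewrite exprM.
  by rewrite -subrX1 exprAC (prim_expr_order z_prim) expr1n subrr.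
move/eqP; rewrite mulf_eq0 subr_eq0 (negPf zj1) /= big_ltn // muln0 expr0.
by rewrite addr_eq0 => /eqP E; rewrite [in RHS]E opprK.
Qed.

(** * Traces, norms and inverses *)

Definition gal_tr x := \sum_(i < p.-1) s i x.
Definition gal_nm x := \prod_(i < p.-1) s i x.

Lemma gal_tr_rat x : Qfield z x -> gal_tr x \in Crat.
Proof.
move=> [c ->]; rewrite /gal_tr.
under eq_bigr do rewrite rmorph_sum.
rewrite exchange_big rpred_sum // => j _ /=.
under eq_bigr do rewrite rmorphM rmorph_ratr rmorphXn iterm_root -exprM mulnC.
rewrite -mulr_sumr sum_z_exp rpredM ?Crat_rat //.
by case: ifP; rewrite ?rpredN ?rpred1 ?rpred_nat.
Qed.

(** [sigma] permutes the factors cyclically, because its power [p.-1] is trivial on Q(z). *)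
Lemma iterm_gal_nm i x : Qfield z x -> s i (gal_nm x) = gal_nm x.
Proof.
move=> xQ; have s1 : sigma (gal_nm x) = gal_nm x.
  rewrite /gal_nm rmorph_prod /= -[RHS](big_mkord xpredT (fun i => s i x)).
  rewrite -(big_mkord xpredT (fun i => sigma (s i x))).
  case E : p.-1 => [|k]; first by rewrite !big_geq.
  rewrite big_nat_recr // big_nat_recl //= mulrC; congr (_ * _).
  by rewrite -[RHS](iterm_pred xQ) E.
by elim: i => //= i ->.
Qed.

Lemma gal_nm_Qfield x : Qfield z x -> Qfield z (gal_nm x).
Proof. by move=> xQ; apply: Qfield_prod => i _; apply: iterm_Qfield. Qed.

(** The norm is Galois invariant, so its trace, which is rational, is p - 1 times the norm
    itself. *)
Lemma gal_nm_rat x : Qfield z x -> gal_nm x \in Crat.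
Proof.
move=> xQ; have := gal_tr_rat (gal_nm_Qfield xQ).
rewrite /gal_tr; under eq_bigr do rewrite iterm_gal_nm //.
rewrite sumr_const card_ord => H.
have p1 : (p.-1%:R : algC) != 0 by rewrite pnatr_eq0; lia.
by rewrite -(mulfK p1 (gal_nm x)) mulr_natr rpred_div ?rpred_nat.
Qed.

Lemma gal_nm_Aint x : x \in Aint -> gal_nm x \in Aint.
Proof. by move=> xA; rewrite rpred_prod // => i _; rewrite Aint_rmorph. Qed.

Lemma gal_nm_int x : Qfield z x -> x \in Aint -> gal_nm x \in Num.int.
Proof. by move=> xQ xA; apply: Cint_rat_Aint; [apply: gal_nm_rat | apply: gal_nm_Aint]. Qed.

Lemma gal_nm_mul x y : gal_nm (x * y) = gal_nm x * gal_nm y.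
Proof. by rewrite -big_split; apply: eq_bigr => i _; rewrite rmorphM. Qed.

Lemma gal_nm_exp x n : gal_nm (x ^+ n) = gal_nm x ^+ n.
Proof. by rewrite -prodrXl; apply: eq_bigr => i _; rewrite rmorphXn. Qed.

Lemma gal_nm_adv x y : adv x y -> adv (gal_nm x) (gal_nm y).
Proof. by move=> xy; apply: adv_prod => i _; apply: adv_rmorph. Qed.

(** * The prime [lam] above p *)

Lemma prod_1subz : \prod_(1 <= k < p) (1 - z ^+ k) = p%:R.
Proof.
(* Cancel X - 1 in the factorization of X^p - 1 and evaluate the remaining cyclotomic polynomial at
   1. *)
have := factor_Xn_sub_1 z_prim; rewrite big_ltn // expr0 subrX1.
move/mulfI => E; rewrite polyXsubC_eq0 in E; have {}E := E isT.
have := congr1 (horner^~ 1) E.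
rewrite -[X in _ = X -> _]/(horner _ _) horner_prod horner_sum /=.
under eq_bigr do rewrite hornerXsubC.
under [in RHS]eq_bigr do rewrite hornerXn expr1n.
by rewrite sumr_const card_ord => ->.
Qed.

Lemma gal_nm_lam : gal_nm (z - 1) = p%:R.
Proof.
rewrite /gal_nm; under eq_bigr do rewrite rmorphB rmorph1 iterm_root_mod.
rewrite (big_v_exp _ (fun k => z ^+ k - 1)) -prod_1subz.
under [in RHS]eq_bigr do rewrite -opprB.
rewrite big_add1 [in RHS]big_add1 !big_mkord prodrN card_ord.
have := odd_double_half p.-1; have -> : odd p.-1 = false by lia.
by rewrite add0n => <-; rewrite -muln2 mulnC exprM sqrrN expr1n expr1n mul1r.
Qed.

Let lam := z - 1.

Lemma lamA : lam \in Aint. Proof. by rewrite rpredB ?rpred1 ?root_Aint. Qed.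

Lemma lamZ : Zring z lam.
Proof. by apply: ZringD; [apply: Zring_gen | apply/ZringN/Zring1]. Qed.

Lemma not_adv_lam1 : ~ adv lam 1.
Proof.
move/gal_nm_adv; rewrite gal_nm_lam => H.
have : adv p%:R 1%:~R by move: H; rewrite /gal_nm big1 // => i _; rewrite rmorph1.
by move/adv_int; rewrite dvdn1 => /eqP p1; have := p_gt1; rewrite p1.
Qed.

Lemma lam_neq0 : lam != 0.
Proof.
apply/eqP => l0; have := gal_nm_lam; rewrite -/lam l0 /gal_nm.
have -> : p.-1 = p.-2.+1 by have := p_gt1; lia.
rewrite big_ord_recl rmorph0 mul0r => /eqP; rewrite eq_sym pnatr_eq0.
by have := p_gt0; lia.
Qed.

Lemma adv_lam_z k : adv lam (z ^+ k - 1).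
Proof. by rewrite -(expr1n _ k); apply: adv_subX; rewrite ?root_Aint ?rpred1 //; apply: advv. Qed.

(** With k' inverse to k modulo p, z is the k'-th power of z^k; so z^k - 1 and [lam] are
    associates. *)
Lemma adv_z_lam k : ~~ (p %| k)%N -> adv (z ^+ k - 1) lam.
Proof.
move=> pk; have [k' kk'] : exists k', (k * k' = 1 %[mod p])%N.
  have k0 : (0 < k)%N by rewrite lt0n; apply: contraNneq pk => ->; rewrite dvdn0.
  case: (egcdnP p k0) => a b E _; exists a; rewrite mulnC E.
  have /eqP -> : coprime k p by rewrite coprime_sym prime_coprime.
  by rewrite modnMDl.
have -> : lam = (z ^+ k) ^+ k' - 1 ^+ k'.
  by rewrite -exprM -(prim_expr_mod z_prim) kk' prim_expr_mod // expr1 expr1n.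
by apply: adv_subX; rewrite ?rpredX ?root_Aint ?rpred1 //; apply: advv.
Qed.

Lemma adv_lam_p : adv (lam ^+ p.-1) p%:R.
Proof.
rewrite -prod_1subz big_add1 big_mkord -[X in lam ^+ X]card_ord -prodr_const.
by apply: adv_prod => i _; rewrite -opprB; apply/advN/adv_lam_z.
Qed.

Lemma adv_p_lam : adv p%:R (lam ^+ p.-1).
Proof.
rewrite -prod_1subz big_add1 big_mkord -[X in lam ^+ X]card_ord -prodr_const.
apply: adv_prod => i _.
have [u uA ->] : adv (z ^+ i.+1 - 1) lam.
  by apply: adv_z_lam; rewrite gtnNdvd // -ltn_predRL ltn_ord.
by exists (- u); [rewrite rpredN | rewrite mulNr -mulrN opprB].
Qed.

Lemma adv_lam_p1 : adv lam p%:R.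
Proof.
apply: adv_trans adv_lam_p; rewrite -{1}[lam]expr1; apply: adv_exp_le => //.
  exact: lamA.
by rewrite -subn1 subn_gt0.
Qed.

Lemma adv_lam_nat (n : nat) : adv lam n%:R -> (p %| n)%N.
Proof.
move=> ln; apply: contraT; rewrite -prime_coprime // => pn.
by case: not_adv_lam1; apply: (adv_coprime pn) => //; apply: adv_lam_p1.
Qed.

Lemma adv_lam_int (n : int) : adv lam n%:~R -> (p %| `|n|)%N.
Proof.
case: (intP n) => {n}[|n|n] ln; first exact: dvdn0.
  by apply: adv_lam_nat.
by rewrite abszN; apply: adv_lam_nat; rewrite -[_%:R]opprK; apply: advN; rewrite rmorphN in ln.
Qed.

(** The inverse is the product of the other conjugates divided by the rational norm. *)
Lemma Qfield_inv x : Qfield z x -> Qfield z x^-1.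
Proof.
move=> xQ; have [->|x0] := eqVneq x 0; first by rewrite invr0; apply: Qfield_Crat; rewrite rpred0.
have p2 : p.-1 = p.-2.+1 by have := p_gt1; lia.
have nmE : gal_nm x = x * \prod_(i < p.-2) s (lift ord0 i) x.
  by rewrite /gal_nm p2 big_ord_recl.
have nm0 : gal_nm x != 0 by rewrite prodf_seq_neq0; apply/allP => i _ /=; rewrite fmorph_eq0.
have -> : x^-1 = (gal_nm x)^-1 * \prod_(i < p.-2) s (lift ord0 i) x.
  by apply: (mulfI x0); rewrite divff // mulrCA -nmE mulVf.
apply: QfieldM; first by apply: Qfield_Crat; rewrite rpredV gal_nm_rat.
by apply: Qfield_prod => i _; apply: iterm_Qfield.
Qed.

(* Peeling off the constant term: it is divisible by lam, hence by p, hence by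
   lam ^+ p.-1, so that one factor lam can be cancelled. *)
Lemma lam_adic_dvd (c : seq int) k : (size c <= k < p)%N ->
  adv (lam ^+ k) (\sum_(i < size c) (c`_i)%:~R * lam ^+ i) ->
  forall i, (p %| `|(c`_i)%R|)%N.
Proof.
elim: c k => [|a c IH] [|k] //= => [_ _ i|_ _ i|/andP[ck kp]].
1,2: by rewrite nth_nil dvdn0.
rewrite big_ord_recl expr0 mulr1 /=.
set S := (X in adv _ (_ + X)).
have SE : S = lam * \sum_(i < size c) (c`_i)%:~R * lam ^+ i.
  by rewrite mulr_sumr; apply: eq_bigr => i _; rewrite /= exprS mulrCA.
set T := (X in lam * X) in SE.
have TA : T \in Aint.
  by apply: rpred_sum => i _; rewrite rpredM ?Aint_int ?rpredX ?lamA.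
rewrite SE => H.
have pa : (p %| `|a|)%N.
  apply: adv_lam_int; rewrite -[a%:~R](addrK (lam * T)).
  apply: advB; last by apply: advMr => //; apply: advv.
  by apply: adv_trans H; rewrite exprS; apply: advMr; rewrite ?rpredX ?lamA //; apply: advv.
have lamT : adv (lam ^+ k) T.
  have : adv (lam ^+ k.+1) (lam * T).
    rewrite -[lam * T](addKr a%:~R); apply: advD => //; apply: advN.
    apply: (@adv_trans p%:R).
      apply: adv_trans adv_lam_p; apply: adv_exp_le; first exact: lamA.
      by lia.
    have /dvdzP[b ->] : (p %| a)%Z by rewrite dvdzE.
    by rewrite rmorphM; exists b%:~R; rewrite ?Aint_int.
  rewrite exprS => -[u uA uE]; exists u => //; apply: (mulfI lam_neq0).
  by rewrite uE mulrCA.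
move=> [|i] //=; apply: (IH k) => //.
by rewrite -ltnS ck; lia.
Qed.

(** * Z[z] is the full ring of integers of Q(z) *)

Lemma mulp_gal_tr x : Qfield z x ->
  p%:R * x = \sum_(j < p) gal_tr (x * z ^- j) * z ^+ j.
Proof.
move=> xQ; rewrite /gal_tr; under eq_bigr do rewrite mulr_suml.
rewrite exchange_big /=.
have p2 : p.-1 = p.-2.+1 by have := p_gt1; lia.
(* Fourier inversion: the geometric sum in z / s_i(z) vanishes unless s_i fixes z, that is i = 0,
   where it equals p. *)
have E i : \sum_(j < p) s i (x * z ^- j) * z ^+ j =
    s i x * \sum_(j < p) (z / s i z) ^+ j.
  rewrite mulr_sumr; apply: eq_bigr => j _.
  by rewrite rmorphM rmorphV ?unitfE ?expf_neq0 ?prim_root_neq0 // rmorphXn expr_div_n mulrAC -mulrA.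
under eq_bigr do rewrite E.
rewrite p2 big_ord_recl /= divff ?prim_root_neq0 //.
under [X in x * X]eq_bigr do rewrite expr1n.
rewrite sumr_const card_ord mulrC big1 ?addr0 // => i _.
set y := z / _.
have y1 : y != 1.
  apply/eqP => /divr1_eq E1.
  have : z ^+ (v ^ (lift ord0 i)) = z ^+ (v ^ 0) by rewrite expn0 expr1 -iterm_root.
  move/eqP; rewrite (eq_prim_root_expr z_prim) => /eqP/v_exp_inj.
  have ip : (lift ord0 i < p.-1)%N by rewrite [X in (_ < X)%N]p2 ltn_ord.
  by move/(_ ip (leq_ltn_trans (leq0n _) ip)).
have : (y - 1) * \sum_(j < p) y ^+ j = 0.
  have yp : y ^+ p = 1.
    rewrite expr_div_n (prim_expr_order z_prim) div1r.
    have H : (s (lift ord0 i) z) ^+ p = 1.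
      by rewrite -rmorphXn (prim_expr_order z_prim) rmorph1.
    by rewrite [X in X^-1]H invr1.
  by rewrite -subrX1 yp subrr.
by move/eqP; rewrite mulf_eq0 subr_eq0 (negPf y1) /= => /eqP ->; rewrite mulr0.
Qed.

(** Traces are integers, so p x is an integer polynomial in z. Rewritten in powers of [lam], its
    coefficients are all divisible by p, and p can be cancelled. *)
Lemma Aint_Qfield_Zring x : Qfield z x -> x \in Aint -> Zring z x.
Proof.
move=> xQ xA.
have trZ j : gal_tr (x * z ^- j) \in Num.int.
  apply: Cint_rat_Aint.
    apply: gal_tr_rat; apply: QfieldM => //; rewrite -exprVn.
    by apply/QfieldX/Qfield_inv/Zring_Qfield/Zring_gen.
  have zVA : z^-1 \in Aint.
    have -> : z^-1 = z ^+ p.-1.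
      apply: (mulfI prim_root_neq0); rewrite -exprS prednK // divff ?prim_root_neq0 //.
      by rewrite (prim_expr_order z_prim).
    by rewrite rpredX ?root_Aint.
  by apply: rpred_sum => i _; rewrite Aint_rmorph // rpredM // -exprVn rpredX.
pose t j := Num.floor (gal_tr (x * z ^- j)).
have tE j : gal_tr (x * z ^- j) = (t j)%:~R by rewrite floorK.
have split (F : nat -> algC) : \sum_(j < p) F j = \sum_(j < p.-1) F j + F p.-1.
  by rewrite -(prednK p_gt0) big_ord_recr.
(* The relation 1 + z + ... + z^(p-1) = 0 removes the top power, leaving the p - 1 coefficients that
   [lam_adic_dvd] can handle. *)
pose U : {poly int} := \poly_(j < p.-1) (t j - t p.-1).
have UE : p%:R * x = (map_poly intr U).[z].
  rewrite mulp_gal_tr // (horner_coef_wide z (n := p.-1)); last first.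
    by apply: leq_trans (size_poly _ _) (size_poly _ _).
  have : \sum_(j < p) z ^+ j = 0.
    have : (z - 1) * \sum_(j < p) z ^+ j = 0.
      by rewrite -subrX1 (prim_expr_order z_prim) subrr.
    by move/eqP; rewrite mulf_eq0 (negPf lam_neq0) => /eqP.
  rewrite (split (fun j => z ^+ j)) => /eqP; rewrite addrC addr_eq0 => /eqP zE.
  rewrite (split (fun j => gal_tr (x * z ^- j) * z ^+ j)) /= (tE p.-1) zE.
  rewrite mulrN mulr_sumr -sumrB; apply: eq_bigr => j _.
  by rewrite tE coef_map coef_poly ltn_ord /= rmorphB mulrBl.
(* Substituting X + 1 turns an expansion at z into one at [lam]. *)
pose V : {poly int} := U \Po ('X + 1).
have VE : (map_poly intr U).[z] = (map_poly intr V).[lam].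
  rewrite /V map_comp_poly horner_comp rmorphD rmorph1 /= map_polyX.
  by rewrite !hornerE subrK.
have sV : (size V <= p.-1)%N.
  rewrite size_comp_poly2 ?size_poly //.
  by rewrite -[1]polyC1 size_XaddC.
have sV' : (size (map_poly intr V : {poly algC}) <= size V)%N by apply: size_poly.
have pV i : (p %| `|(V`_i)%R|)%N.
  apply: (@lam_adic_dvd V p.-1); first by rewrite sV /=; lia.
  have -> : \sum_(i < size V) (V`_i)%:~R * lam ^+ i = p%:R * x.
    rewrite UE VE (horner_coef_wide _ sV'); apply: eq_bigr => j _.
    by rewrite coef_map.
  by apply: advMr => //; apply: adv_lam_p.
pose W : {poly int} := \poly_(i < size V) (V`_i %/ p)%Z.
have -> : x = (map_poly intr W).[lam].
  have p0 : (p%:R : algC) != 0 by rewrite pnatr_eq0; lia.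
  apply: (mulfI p0); rewrite UE VE (horner_coef_wide _ sV').
  rewrite (horner_coef_wide (n := size V)); last first.
    by apply: leq_trans (size_poly _ _) (size_poly _ _).
  rewrite mulr_sumr; apply: eq_bigr => j _.
  rewrite !coef_map coef_poly ltn_ord /= mulrA; congr (_ * _).
  rewrite -[p%:R]/(p%:~R) -rmorphM /= mulrC divzK //.
  by rewrite dvdzE pV.
rewrite (horner_coef _); apply: Zring_sum => i _.
by apply: ZringM; [rewrite coef_map; apply: Zring_int | apply/ZringX/lamZ].
Qed.

(** * Congruences modulo powers of [lam] *)

Lemma adv_lam_cong x y k : Qfield z x -> Qfield z y ->
  adv (lam ^+ k) (x - y) -> cong_pi z k x y.
Proof.
move=> xQ yQ [u uA uE]; exists u; split; last by rewrite mulrC.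
(* The quotient is an algebraic integer of Q(z), so it lies in Z[z], as the congruence of the
   statement demands. *)
apply: Aint_Qfield_Zring => //.
have -> : u = (x - y) * lam^-1 ^+ k.
  by rewrite uE exprVn mulfK // expf_neq0 // lam_neq0.
by apply: QfieldM; [apply: QfieldB | apply/QfieldX/Qfield_inv/Zring_Qfield/lamZ].
Qed.

Lemma cong_pi_adv x y k : cong_pi z k x y -> adv (lam ^+ k) (x - y).
Proof.
by move=> [w [wZ ->]]; exists w; [apply: Zring_Aint wZ; apply: root_Aint | rewrite mulrC].
Qed.

(** In x^p - 1 = prod (x - z^i) the factor with i = 0 contributes [lam ^+ k] and each of the p - 1
    others at least one [lam]. *)
Lemma adv_lam_frob x k : (0 < k)%N ->
  adv (lam ^+ k) (x - 1) -> adv (lam ^+ (k + p.-1)) (x ^+ p - 1).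
Proof.
move=> k0 xk; have := congr1 (horner^~ x) (factor_Xn_sub_1 z_prim).
rewrite /= horner_prod !hornerE => <-.
under eq_bigr do rewrite hornerXsubC.
rewrite big_ltn // expr0 exprD; apply: advM => //.
rewrite big_add1 big_mkord -[X in lam ^+ X]card_ord -prodr_const.
apply: adv_prod => i _.
have -> : x - z ^+ i.+1 = (x - 1) - (z ^+ i.+1 - 1) by rewrite opprB addrA subrK.
apply: advB; last exact: adv_lam_z.
by apply: adv_trans xk; rewrite -{1}[lam]expr1; apply: adv_exp_le; rewrite ?lamA.
Qed.

Lemma adv_lam_frobX x k n : (0 < k)%N ->
  adv (lam ^+ k) (x - 1) -> adv (lam ^+ (k + n)) (x ^+ (p ^ n) - 1).
Proof.
move=> k0 xk; elim: n => [|n IH]; first by rewrite addn0 expn0 expr1.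
rewrite expnSr exprM; have kn : (0 < k + n)%N by rewrite addn_gt0 k0.
apply: adv_trans (adv_lam_frob kn IH); apply: adv_exp_le; first exact: lamA.
by have := p_gt1; lia.
Qed.

(* The norm of eta ^+ (p ^ p) - 1 is at most 2 ^ p.-1 but divisible by p ^ p. *)
Lemma unit_circle_eq1 eta : Qfield z eta -> eta \in Aint ->
  (forall i, `|s i eta| = 1) -> adv (lam ^+ 2) (eta - 1) -> eta = 1.
Proof.
move=> eQ eA e1 el.
have eX1 : eta ^+ (p ^ p) = 1.
  set y := eta ^+ (p ^ p) - 1.
  have yQ : Qfield z y by apply: QfieldB; [apply: QfieldX | apply: Qfield1].
  have yA : y \in Aint by rewrite rpredB ?rpredX ?rpred1.
  have yl : adv (lam ^+ p) y.
    apply: (@adv_trans (lam ^+ (2 + p))); last exact: adv_lam_frobX.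
    by apply: adv_exp_le; rewrite ?lamA // leq_addl.
  have /intrP[t tE] := gal_nm_int yQ yA.
  have nle : `|gal_nm y| <= 2%:R ^+ p.-1.
    rewrite /gal_nm normr_prod -[X in _ <= _ ^+ X]card_ord -prodr_const.
    apply: ler_prod => i _; rewrite normr_ge0 /= rmorphB rmorph1 rmorphXn.
    apply: le_trans (ler_normB _ _) _.
    by rewrite normrX e1 expr1n normr1.
  have : (p ^ p %| `|t|)%N.
    by apply: adv_int; rewrite -tE natrX -gal_nm_lam -gal_nm_exp; apply: gal_nm_adv.
  have tlt : (`|t| < p ^ p)%N.
    rewrite -(ltr_nat algC) natr_absz intr_norm -tE; apply: le_lt_trans nle _.
    rewrite -natrX ltr_nat; apply: (@leq_ltn_trans (p ^ p.-1)).
      by rewrite leq_exp2r //; have := p_gt1; lia.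
    by rewrite ltn_exp2l //; lia.
  move=> pt; have t0 : t = 0.
    apply/eqP; rewrite -absz_eq0; apply: contraTT tlt.
    by rewrite -lt0n -leqNgt => /dvdn_leq; apply.
  move/eqP: tE; rewrite t0 prodf_seq_eq0 => /hasP[i _ /=].
  by rewrite fmorph_eq0 subr_eq0 => /eqP.
have [n en] : exists n, eta ^+ (p ^ n) = 1 by exists p.
(* Descent on n: each r = eta^(p^n) is a p-th root of unity that is 1 modulo [lam ^+ 2]. A
   nontrivial one would differ from 1 by an associate of [lam], so r = 1. *)
elim: n en => [|n IH]; first by rewrite expn0 expr1.
rewrite expnSr exprM => en; apply: IH; set r := eta ^+ _ in en *.
have [k rE] := prim_rootP z_prim en.
have [pk|pk] := boolP (p %| k)%N.
  by apply/eqP; rewrite rE -(prim_order_dvd z_prim).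
case: not_adv_lam1.
have rl : adv (lam ^+ 2) (r - 1).
  by rewrite -(expr1n _ (p ^ n)); apply: adv_subX; rewrite ?rpred1.
have [u uA uE] : adv (lam ^+ 2) lam.
  by apply: adv_trans rl _; rewrite rE; apply: adv_z_lam.
exists u => //; apply: (mulfI lam_neq0); rewrite mulr1 {1}uE expr2.
by rewrite mulrA mulrC.
Qed.

End Cyclotomic.

(** * Gauss sums *)

Section PowerSums.

Variables (l : nat).
Hypothesis l_pr : prime l.

Lemma Fp_exp_pred (x : 'F_l) : x != 0 -> x ^+ l.-1 = 1.
Proof.
move=> x0; apply: (mulfI x0); rewrite -exprS prednK ?prime_gt0 // mulr1.
by have := expf_card x; rewrite card_Fp.
Qed.

Lemma Fp_natr_eq0 (n : nat) : ((n%:R : 'F_l) == 0) = (l %| n)%N.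
Proof. by rewrite (dvdn_pcharf (pchar_Fp l_pr)). Qed.

(** X^k - 1 has at most k roots, fewer than the l - 1 nonzero elements. *)
Lemma Fp_exists_exp_neq1 k : (0 < k < l.-1)%N ->
  exists2 y : 'F_l, y != 0 & y ^+ k != 1.
Proof.
move=> /andP[k0 kl].
have [/exists_inP[y y0 y1]|] := boolP [exists y in [pred y : 'F_l | y != 0], y ^+ k != 1].
  by exists y.
rewrite negb_exists_in => /forall_inP H.
have : (size (enum [pred y : 'F_l | y != 0%R]) < size ('X^k - 1 : {poly 'F_l})%R)%N.
  apply: max_poly_roots; rewrite ?enum_uniq //.
    by rewrite -size_poly_eq0 size_XnsubC.
  apply/allP => y; rewrite mem_enum => /H; rewrite negbK => /eqP y1.
  by rewrite rootE !hornerE y1 subrr.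
rewrite size_XnsubC // -cardE.
have -> : #|[pred y : 'F_l | y != 0]| = l.-1.
  by rewrite (cardC1 (0 : 'F_l)) card_Fp.
by lia.
Qed.

Lemma Fp_sum_exp k : (k < l.-1)%N -> \sum_(x : 'F_l) x ^+ k = 0.
Proof.
case: k => [_|k kl].
  rewrite sumr_const card_Fp //; apply/eqP.
  by rewrite Fp_natr_eq0.
have [y y0 y1] := Fp_exists_exp_neq1 (k := k.+1) kl.
have /eqP : (y ^+ k.+1 - 1) * \sum_(x : 'F_l) x ^+ k.+1 = 0.
  rewrite mulrBl mul1r mulr_sumr [X in _ - X](reindex_inj (mulfI y0)) /=.
  by under [X in _ - X]eq_bigr do rewrite exprMn; rewrite subrr.
by rewrite mulf_eq0 subr_eq0 (negPf y1) => /eqP.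
Qed.

Lemma Fp_sum_poly (Q : {poly 'F_l}) : (size Q <= l.-1)%N ->
  \sum_(x : 'F_l) Q.[x] = 0.
Proof.
move=> sQ; under eq_bigr do rewrite horner_coef.
rewrite exchange_big big1 // => i _ /=.
by rewrite -mulr_sumr Fp_sum_exp ?mulr0 // (leq_trans (ltn_ord i)).
Qed.

Lemma natr_ffact (R : comNzRingType) (x j : nat) :
  (x ^_ j)%:R = \prod_(i < j) (x%:R - i%:R) :> R.
Proof.
elim: j => [|j IH]; first by rewrite big_ord0 ffactn0.
rewrite big_ord_recr /= -IH ffactnSr natrM.
have [jx|xj] := leqP j x; first by rewrite natrB.
by rewrite ffact_small // mul0r mul0r.
Qed.

Lemma prime_dvd_fact j : (l %| j`!)%N -> (l <= j)%N.
Proof.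
elim: j => [|j IH]; first by rewrite fact0 dvdn1 => /eqP l1; have := l_pr; rewrite l1.
rewrite factS Euclid_dvdM // => /orP[/dvdn_leq->//|/IH]; exact: leqW.
Qed.

(** Since j! is prime to l, multiply by it: j! times the binomial coefficient is a polynomial of
    degree j in x, and the values of a polynomial of degree below l - 1 sum to 0. *)
Lemma dvdn_sum_exp_bin k j : (k + j < l.-1)%N ->
  (l %| \sum_(x : 'F_l) (x : nat) ^ k * 'C(x, j))%N.
Proof.
move=> kj; have jl : coprime l j`!.
  by rewrite prime_coprime //; apply: contraL kj => /prime_dvd_fact; lia.
rewrite -(Gauss_dvdl _ jl) -Fp_natr_eq0 big_distrl /= natr_sum.
pose Q : {poly 'F_l} := 'X^k * \prod_(i < j) ('X - (i%:R)%:P).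
rewrite (eq_bigr (fun x : 'F_l => Q.[x])) => [|x _].
  rewrite Fp_sum_poly // size_mul ?monic_neq0 ?monicXn ?monic_prod_XsubC //.
  by rewrite size_polyXn size_prod_XsubC /= /index_enum -enumT size_enum_ord; lia.
rewrite -mulnA bin_ffact natrM natrX natr_ffact natr_Zp hornerM hornerXn.
by congr (_ * _); rewrite horner_prod; apply: eq_bigr => i _; rewrite hornerXsubC.
Qed.

End PowerSums.

Lemma expr1D_bin (R : comNzRingType) (y : R) n m : (n < m)%N ->
  (1 + y) ^+ n = \sum_(j < m) 'C(n, j)%:R * y ^+ j.
Proof.
move=> gal_nm; rewrite exprDn (big_ord_widen m (fun j => 1 ^+ (n - j) * y ^+ j *+ 'C(n, j))) //.
rewrite big_mkcond /=; apply: eq_bigr => j _; rewrite expr1n mul1r mulr_natl.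
by case: ltnP => // nj; rewrite bin_small.
Qed.

(** * The Gauss sum of a character of order p *)

Section GaussSum.

Variables (p l d : nat) (z xi : algC) (r : 'F_l).
Hypotheses (p_pr : prime p) (l_pr : prime l) (l_pd : l.-1 = (p * d)%N).
Hypotheses (z_prim : p.-primitive_root z) (xi_prim : l.-primitive_root xi).
Hypothesis r_prim : p.-primitive_root r.

Let p_gt1 := prime_gt1 p_pr.
Let l_gt1 := prime_gt1 l_pr.

Lemma d_gt0 : (0 < d)%N.
Proof. by move: l_pd l_gt1; case: d => //; rewrite muln0; lia. Qed.

(* An exponent with r ^+ chi_log x = x ^+ - d. *)
Definition chi_log (x : 'F_l) : nat :=
  odflt (Ordinal (prime_gt0 p_pr)) [pick k : 'I_p | r ^+ k == x ^+ (d * p.-1)].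

(** The inverse of the p-th power residue character, z being matched with [r]: it reduces to x^(-d),
    and is extended by 0. *)
Definition chi (x : 'F_l) : algC := if x == 0 then 0 else z ^+ chi_log x.

Lemma chi_logE x : x != 0 -> r ^+ chi_log x = x ^+ (d * p.-1).
Proof.
move=> x0; rewrite /chi_log; case: pickP => [k /eqP //|/= H].
have : (x ^+ (d * p.-1)) ^+ p = 1.
  rewrite -exprM mulnAC [(d * p)%N]mulnC -l_pd exprM Fp_exp_pred //.
  by rewrite expr1n.
by case/(prim_rootP r_prim) => k kE; have := H k; rewrite kE eqxx.
Qed.

Lemma chiE x k : x != 0 -> r ^+ k = x ^+ (d * p.-1) -> chi x = z ^+ k.
Proof.
move=> x0 kE; rewrite /chi (negPf x0); apply/eqP.
by rewrite (eq_prim_root_expr z_prim) -(eq_prim_root_expr r_prim) chi_logE // kE.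
Qed.

Lemma chi0 : chi 0 = 0. Proof. by rewrite /chi eqxx. Qed.

Lemma chi_neq0 x : x != 0 -> chi x != 0.
Proof.
by move=> x0; rewrite /chi (negPf x0) expf_neq0 // (prim_root_neq0 p_pr z_prim).
Qed.

Lemma chiM x y : chi (x * y) = chi x * chi y.
Proof.
have [->|x0] := eqVneq x 0; first by rewrite mul0r chi0 mul0r.
have [->|y0] := eqVneq y 0; first by rewrite mulr0 chi0 mulr0.
rewrite (@chiE _ (chi_log x + chi_log y)) ?mulf_neq0 //.
  by rewrite exprD /chi (negPf x0) (negPf y0).
by rewrite exprD !chi_logE // exprMn.
Qed.

Lemma chi_exp_p x : x != 0 -> chi x ^+ p = 1.
Proof.
by move=> x0; rewrite /chi (negPf x0) exprAC (prim_expr_order z_prim) expr1n.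
Qed.

Lemma chi_nontriv : exists2 y, y != 0 & chi y != 1.
Proof.
have [|y y0 y1] := Fp_exists_exp_neq1 l_pr (k := (d * p.-1)%N).
  by have := d_gt0; rewrite l_pd mulnC; nia.
exists y => //; apply: contra y1; rewrite /chi (negPf y0).
rewrite -(prim_order_dvd z_prim) => pe; rewrite -chi_logE //.
by rewrite -(prim_order_dvd r_prim).
Qed.

Lemma chi_Zring x : Zring z (chi x).
Proof.
rewrite /chi; case: ifP => _; first exact: (Zring_int z 0).
exact/ZringX/Zring_gen.
Qed.

Let zAint : z \in Aint := Aint_prim_root z_prim.
Let xiA : xi \in Aint := Aint_prim_root xi_prim.

Lemma chiA x : chi x \in Aint.
Proof. exact: Zring_Aint (chi_Zring x). Qed.

Lemma sum_chi : \sum_x chi x = 0.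
Proof.
have [y y0 y1] := chi_nontriv.
have /eqP : (chi y - 1) * \sum_x chi x = 0.
  rewrite mulrBl mul1r mulr_sumr [X in _ - X](reindex_inj (mulfI y0)) /=.
  by under [X in _ - X]eq_bigr do rewrite chiM; rewrite subrr.
by rewrite mulf_eq0 subr_eq0 (negPf y1) => /eqP.
Qed.

Definition psi (x : 'F_l) : algC := xi ^+ x.

Lemma psiD x y : psi (x + y) = psi x * psi y.
Proof.
have E : (x + y)%R = ((x + y) %% l)%N :> nat.
  by rewrite -[X in (_ %% X)%N](Fp_cast l_pr).
by rewrite /psi E prim_expr_mod // exprD.
Qed.

Lemma psi0 : psi 0 = 1. Proof. by []. Qed.

Lemma psi_neq0 x : psi x != 0.
Proof. by rewrite expf_neq0 // (prim_root_neq0 l_pr xi_prim). Qed.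

Lemma psiN x : psi (- x) = (psi x)^-1.
Proof.
by apply: (mulfI (psi_neq0 x)); rewrite -psiD subrr divff // psi_neq0.
Qed.

Lemma psiA x : psi x \in Aint. Proof. by rewrite rpredX. Qed.

Lemma sum_psi : \sum_x psi x = 0.
Proof.
have y1 : psi 1 != 1.
  rewrite /psi -(prim_order_dvd xi_prim) /= Fp_cast // modn_small //.
  by rewrite dvdn1; lia.
have /eqP : (psi 1 - 1) * \sum_x psi x = 0.
  rewrite mulrBl mul1r mulr_sumr [X in _ - X](reindex_inj (addrI 1)) /=.
  by under [X in _ - X]eq_bigr do rewrite psiD; rewrite subrr.
by rewrite mulf_eq0 subr_eq0 (negPf y1) => /eqP.
Qed.

Lemma sum_psiM x : \sum_t psi (t * x) = if x == 0 then l%:R else 0.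
Proof.
have [->|x0] := eqVneq x 0.
  under eq_bigr do rewrite mulr0 psi0.
  by rewrite sumr_const card_Fp.
by rewrite -[RHS]sum_psi [in RHS](reindex_inj (mulIf x0)).
Qed.

Definition gauss_at t := \sum_x chi x * psi (t * x).
(** The complex conjugate written with inverses, so that it can be carried through an arbitrary
    morphism. The term x = 0 vanishes since the inverse of 0 is 0. *)
Definition gauss_inv_at t := \sum_x (chi x)^-1 * (psi (t * x))^-1.
Definition gauss := gauss_at 1.
Definition gauss_inv := gauss_inv_at 1.

Lemma gaussE : gauss = \sum_x chi x * psi x.
Proof. by apply: eq_bigr => x _; rewrite mul1r. Qed.

Lemma gaussA : gauss \in Aint.
Proof. by apply: rpred_sum => x _; rewrite rpredM ?chiA ?psiA. Qed.

Lemma gauss_at0 : gauss_at 0 = 0.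
Proof.
rewrite /gauss_at; under eq_bigr do rewrite mul0r psi0 mulr1.
exact: sum_chi.
Qed.

Lemma chi_gauss_at t : t != 0 -> chi t * gauss_at t = gauss.
Proof.
move=> t0; rewrite gaussE mulr_sumr [RHS](reindex_inj (mulfI t0)) /=.
by apply: eq_bigr => x _; rewrite chiM mulrA.
Qed.

Lemma chi_gauss_inv_at t : t != 0 -> (chi t)^-1 * gauss_inv_at t = gauss_inv.
Proof.
move=> t0; rewrite /gauss_inv /gauss_inv_at mulr_sumr.
rewrite [RHS](reindex_inj (mulfI t0)) /=.
by apply: eq_bigr => x _; rewrite chiM invfM mulrA mul1r.
Qed.

Lemma card_Fp_neq0 : #|[pred t : 'F_l | t != 0]| = l.-1.
Proof. by rewrite (cardC1 (0 : 'F_l)) card_Fp. Qed.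

Lemma natr_pred_neq0 : (l.-1%:R : algC) != 0.
Proof. by rewrite pnatr_eq0; lia. Qed.

(** Sum [gauss_at t * gauss_inv_at t] over all t in two ways: each nonzero t gives the same product
    and t = 0 gives nothing, while orthogonality of additive characters gives (l - 1) l. *)
Lemma gauss_mul_inv : gauss * gauss_inv = l%:R.
Proof.
apply: (mulfI natr_pred_neq0).
have -> : l.-1%:R * (gauss * gauss_inv) = \sum_t gauss_at t * gauss_inv_at t.
  rewrite [RHS](bigD1 0) //= gauss_at0 mul0r add0r.
  rewrite (eq_bigr (fun=> gauss * gauss_inv)) => [|t t0].
    by rewrite sumr_const card_Fp_neq0 mulr_natl.
  rewrite -(chi_gauss_at t0) -(chi_gauss_inv_at t0) mulrACA.
  by rewrite divff ?mul1r // chi_neq0.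
under eq_bigr do rewrite big_distrlr /=.
rewrite exchange_big /=; under eq_bigr do rewrite exchange_big /=.
have E x y : \sum_t chi x * psi (t * x) * ((chi y)^-1 * (psi (t * y))^-1) =
    chi x / chi y * (if x == y then l%:R else 0).
  rewrite -subr_eq0 -sum_psiM mulr_sumr; apply: eq_bigr => t _.
  by rewrite mulrACA mulrBr psiD psiN.
under eq_bigr do under eq_bigr do rewrite E.
have F x : \sum_y chi x / chi y * (if x == y then l%:R else 0) =
    if x == 0 then 0 else l%:R :> algC.
  rewrite (bigD1 x) // eqxx big1 /= ?addr0 => [|y /negPf yx].
    case: eqP => [->|/eqP x0]; first by rewrite chi0 !mul0r.
    by rewrite divff ?mul1r ?chi_neq0.
  by rewrite eq_sym yx mulr0.
under eq_bigr do rewrite F.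
rewrite (bigD1 0) //= add0r (eq_bigr (fun=> l%:R)) => [|x /negPf-> //].
by rewrite sumr_const card_Fp_neq0 mulr_natl.
Qed.

(** The coefficients are iterated convolutions of [chi]; what matters is that they lie in Z[z] and
    do not depend on t. *)
Lemma gauss_exp_expand n : exists N : 'F_l -> algC,
  (forall y, Zring z (N y)) /\
  forall t, gauss_at t ^+ n = \sum_y N y * psi (t * y).
Proof.
elim: n => [|n [N [NZ NE]]].
  exists (fun y => (y == 0)%:R); split=> [y|t]; first exact: Zring_nat.
  rewrite expr0 (bigD1 0) // eqxx mulr0 psi0 mulr1 big1 /= ?addr0 // => y.
  by move/negPf->; rewrite mul0r.
exists (fun y => \sum_x chi x * N (y - x)); split=> [y|t].
  by apply: Zring_sum => x _; apply: ZringM => //; apply: chi_Zring.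
rewrite exprS NE /gauss_at big_distrlr /=.
under [RHS]eq_bigr do rewrite mulr_suml.
rewrite [RHS]exchange_big; apply: eq_bigr => x _ /=.
rewrite [RHS](reindex_inj (addrI x)) /=; apply: eq_bigr => y _.
by rewrite addrAC subrr add0r mulrDr psiD mulrACA.
Qed.

(* Averaging gauss_at t ^+ p over t keeps only the coefficient of psi 0. *)
Lemma gauss_exp_Qfield : Qfield z (gauss ^+ p).
Proof.
have [N [NZ NE]] := gauss_exp_expand p.
have -> : gauss ^+ p = l.-1%:R^-1 * (l%:R * N 0).
  apply: (mulfI natr_pred_neq0); rewrite mulrA divff ?natr_pred_neq0 // mul1r.
  have -> : l.-1%:R * gauss ^+ p = \sum_t gauss_at t ^+ p.
    rewrite [RHS](bigD1 0) //= gauss_at0 expr0n gtn_eqF ?prime_gt0 // add0r.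
    rewrite (eq_bigr (fun=> gauss ^+ p)) => [|t t0].
      by rewrite sumr_const card_Fp_neq0 mulr_natl.
    by rewrite -(chi_gauss_at t0) exprMn chi_exp_p // mul1r.
  under eq_bigr do rewrite NE.
  rewrite exchange_big /=; under eq_bigr do rewrite -mulr_sumr sum_psiM.
  rewrite (bigD1 0) // eqxx big1 /= => [|y /negPf->]; last by rewrite mulr0.
  by rewrite addr0; apply: mulrC.
apply: QfieldM; first by apply: Qfield_Crat; rewrite rpredV rpred_nat.
by apply/Zring_Qfield/ZringM => //; apply: Zring_nat.
Qed.

Lemma gauss_conj (f : {rmorphism algC -> algC}) : (f gauss)^* = f gauss_inv.
Proof.
have conj_root (u : algC) n : (0 < n)%N -> u ^+ n = 1 -> (f u)^* = f u^-1.
  move=> n0 un; rewrite fmorphV; have fn : `|f u| = 1.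
    have : `|f u| ^+ n == 1 by rewrite -normrX -rmorphXn un rmorph1 normr1.
    by rewrite pexpr_eq1 // => /eqP.
  have f0 : f u != 0 by rewrite -normr_eq0 fn oner_eq0.
  by apply: (mulfI f0); rewrite -normCK fn expr1n divff.
rewrite /gauss /gauss_inv /gauss_at /gauss_inv_at !rmorph_sum.
apply: eq_bigr => x _; rewrite !rmorphM; congr (_ * _).
  have [->|x0] := eqVneq x 0; first by rewrite chi0 invr0 !rmorph0.
  exact: conj_root (prime_gt0 p_pr) (chi_exp_p x0).
apply: (conj_root _ _ (prime_gt0 l_pr)).
by rewrite /psi exprAC (prim_expr_order xi_prim) expr1n.
Qed.

Lemma gauss_norm (f : {rmorphism algC -> algC}) : `|f gauss| ^+ 2 = l%:R.
Proof. by rewrite normCK gauss_conj -rmorphM gauss_mul_inv rmorph_nat. Qed.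

(** Modulo z - 1 every nonzero value of [chi] is 1, and the additive character sums to -1 over the
    nonzero elements. *)
Lemma gauss_cong : adv (z - 1) (gauss + 1).
Proof.
have -> : gauss + 1 = \sum_(x | x != 0) (chi x - 1) * psi x.
  under eq_bigr do rewrite mulrBl mul1r.
  rewrite sumrB gaussE (bigD1 0) //= chi0 mul0r add0r; congr (_ + _).
  by have := sum_psi; rewrite (bigD1 0) //= psi0 => /eqP; rewrite addr_eq0 => /eqP.
apply: adv_sum => x x0; apply: advMr; first exact: psiA.
by rewrite /chi (negPf x0); apply: adv_lam_z z_prim _.
Qed.

(* Stickelberger: a plays the part of a prime above l at which z reduces to
   r ^+ s.  In tau = \sum_j (\sum_x chi x * 'C(x, j)) * (xi - 1) ^+ j the
   coefficients with j < s * d vanish modulo a. *)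
Lemma stickelberger (a : algC) s : (0 < s < p)%N -> a \in Aint -> adv a l%:R ->
  adv a (z - ((r ^+ s : 'F_l) : nat)%:R) -> adv (a ^+ s) (gauss ^+ p).
Proof.
move=> /andP[s0 sp] a_Aint al az.
have p0 := prime_gt0 p_pr; have d0 := d_gt0.
(* As (xi - 1)^(l-1) is a multiple of l and l - 1 = p d, this c divides (xi - 1)^d. It therefore
   suffices to show that c^s divides the Gauss sum. *)
pose c := p.-root a; have cp : c ^+ p = a by apply: rootCK.
have cA : c \in Aint by apply: (@Aint_root_exp p) => //; rewrite cp.
have cXi : adv c ((xi - 1) ^+ d).
  apply: (@adv_root p) => //; rewrite cp -exprM mulnC -l_pd.
  exact: adv_trans al (adv_p_lam l_pr xi_prim).
have XiA : xi - 1 \in Aint by rewrite rpredB ?rpred1.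
rewrite -cp -exprM mulnC exprM; apply: advX.
have -> : gauss = \sum_(j < l) (\sum_x chi x * 'C(x, j)%:R) * (xi - 1) ^+ j.
  under [RHS]eq_bigr do rewrite mulr_suml.
  rewrite gaussE exchange_big; apply: eq_bigr => x _ /=.
  have xl : (x < l)%N by rewrite -[X in (_ < X)%N](Fp_cast l_pr) ltn_ord.
  rewrite /psi -{1}[xi](subrK 1) addrC (expr1D_bin _ xl) mulr_sumr.
  by apply: eq_bigr => j _; rewrite mulrA.
apply: adv_sum => j _; have [jsd|sdj] := ltnP j (s * d); last first.
  apply: advMl; first by apply: rpred_sum => x _; rewrite rpredM ?chiA ?rpred_nat.
  apply: adv_trans (adv_exp_le XiA sdj).
  by rewrite mulnC exprM; apply: advX.
apply: advMr; first by rewrite rpredX.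
apply: (@adv_trans a); first by rewrite -cp; apply: adv_exp_le => //; apply: ltnW.
(* Modulo [a], z reduces to r^s and chi(x) to x^(-ds), which is x^k because l - 1 = p d. For j < s d
   one has k + j < l - 1, so the power sums vanish modulo l. *)
pose k := (d * (p - s))%N.
have -> : \sum_x chi x * 'C(x, j)%:R = \sum_(x : 'F_l) (chi x - (x : nat)%:R ^+ k) * 'C(x, j)%:R
    + (\sum_(x : 'F_l) (x : nat) ^ k * 'C(x, j))%:R.
  rewrite natr_sum -big_split; apply: eq_bigr => x _ /=.
  by rewrite natrM natrX mulrBl subrK.
apply: advD; last first.
  apply: adv_trans al _; have /dvdnP[t ->] : (l %| \sum_(x : 'F_l) (x : nat) ^ k * 'C(x, j))%N.
    by apply: dvdn_sum_exp_bin => //; rewrite /k l_pd; nia.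
  by rewrite natrM; exists t%:R; rewrite ?rpred_nat.
have k0 : (0 < k)%N by rewrite muln_gt0 d0 subn_gt0.
apply: adv_sum => x _; apply: advMr; first by rewrite rpred_nat.
have [->|x0] := eqVneq x 0.
  by rewrite chi0 expr0n gtn_eqF // subrr; apply: adv0.
pose n : nat := (r ^+ s : 'F_l).
have -> : chi x - (x : nat)%:R ^+ k =
    (z ^+ chi_log x - n%:R ^+ chi_log x) + (n%:R ^+ chi_log x - (x : nat)%:R ^+ k).
  by rewrite /chi (negPf x0) addrA subrK.
apply: advD; first by apply: adv_subX; rewrite ?rpred_nat.
apply: adv_trans al _; rewrite -!natrX.
have E : (n ^ chi_log x = (x : nat) ^ k %[mod l])%N.
  have H : ((n ^ chi_log x)%:R : 'F_l) = ((x : nat) ^ k)%:R.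
    rewrite !natrX !natr_Zp -exprM mulnC exprM chi_logE // -!exprM.
    have -> : (d * p.-1 * s = k + l.-1 * (s - 1))%N by rewrite l_pd /k; nia.
    by rewrite exprD exprM Fp_exp_pred // expr1n mulr1.
  by move/(congr1 val): H; rewrite /= !val_Fp_nat.
rewrite (divn_eq (n ^ chi_log x) l) (divn_eq ((x : nat) ^ k) l) E !natrD opprD addrACA.
rewrite subrr addr0 !natrM -mulrBl; exists ((n ^ chi_log x %/ l)%:R - ((x : nat) ^ k %/ l)%:R) => //.
by rewrite rpredB ?rpred_nat.
Qed.

End GaussSum.

(** * The prime ideal q and its p-th power *)

Section IdealPowers.

Variables (z : algC) (q : cset).
Hypothesis q_ideal : is_ideal (Zring z) q.

Lemma ideal_pow_sub_Zring n x : ideal_pow (Zring z) q n x -> Zring z x.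
Proof.
case: q_ideal => qR _ _ _; elim: n x => [|n IH] x /=.
  by move=> [r [rR ->]]; rewrite mul1r.
move=> [c [cP ->]]; rewrite big_seq; apply: Zring_sum => u /cP[u1 u2].
by apply: ZringM; [apply: qR | apply: IH].
Qed.

Lemma ideal_powS_sub n x : ideal_pow (Zring z) q n.+1 x -> q x.
Proof.
case: q_ideal => qR q0 qD qM [c [cP ->]].
rewrite big_seq; apply: big_ind => // u /cP[u1 u2].
by rewrite mulrC; apply: qM => //; apply: ideal_pow_sub_Zring u2.
Qed.

Lemma exp_ideal_pow n x : q x -> ideal_pow (Zring z) q n (x ^+ n).
Proof.
move=> qx; elim: n => [|n IH]; first by exists 1; split; [apply: Zring1 | rewrite mul1r].
exists [:: (x, x ^+ n)]; split; last by rewrite big_seq1 exprS.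
by move=> u; rewrite inE => /eqP->.
Qed.

End IdealPowers.

(** Here m lies in the ideal (x, y) and n in (x), so a Bezout relation between m and n puts 1 in (x,
    y). *)
Lemma acop_of_comb x y u v (m n : nat) : coprime m n -> (0 < m)%N ->
  u \in Aint -> v \in Aint -> m%:R = u * x + v * y -> adv x n%:R -> acop x y.
Proof.
move=> mn m0 uA vA mE [r rA rE].
case: (egcdnP n m0) => a b E _; rewrite (eqP mn) in E.
exists (a%:R * u - b%:R * r), (a%:R * v); split.
- by rewrite rpredB ?rpredM ?rpred_nat.
- by rewrite rpredM ?rpred_nat.
- transitivity (a%:R * m%:R - b%:R * n%:R : algC); first by rewrite mE rE; ring.
  by rewrite -!natrM E natrD addrAC subrr add0r.
Qed.

(** * The p-th root [a] of A and the ideal q *)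

Section Main.

Variables (p : nat) (z : algC) (v w : nat) (sigma : {rmorphism algC -> algC}).
Variables (q : cset) (A D : algC).
Hypotheses (p_pr : prime p) (p_odd : odd p) (z_prim : p.-primitive_root z).
Hypotheses (v_prim : primitive_root_mod p v) (vw : (v * w %% p = 1)%N).
Hypothesis sigmaz : sigma z = z ^+ v.
Hypotheses (q_prime : prime_ideal (Zring z) q).
Hypothesis AR : Zring z A.
Hypothesis A_qp : seteq (principal (Zring z) A) (ideal_pow (Zring z) q p).
Hypothesis A_cong : adv ((z - 1) ^+ 3) (A - 1).
Hypotheses (DO : Oplus z D) (AD : A * A^* = D ^+ p).

Notation s := (iterm sigma).
Let lam := z - 1.
Let p_gt0 := prime_gt0 p_pr.
Let p_gt1 := prime_gt1 p_pr.
Let zAint : z \in Aint := root_Aint z_prim.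
Let lamAint : lam \in Aint := lamA z_prim.

Lemma q_ideal : is_ideal (Zring z) q. Proof. by case: q_prime => [[]]. Qed.

Lemma A_in_q : q A.
Proof.
have pS : p = p.-1.+1 by rewrite prednK.
apply: (@ideal_powS_sub z q q_ideal p.-1); rewrite -pS; apply/A_qp.
by exists 1; split; [apply: Zring1 | rewrite mulr1].
Qed.

Lemma A_Aint : A \in Aint. Proof. exact: Zring_Aint AR. Qed.

(** An integral inverse of A would lie in Z[z], and A in q would then put 1 in the prime ideal q. *)
Lemma A_nonunit : ~ adv A 1.
Proof.
move=> [u uA uE]; case: q_prime => _ + _; apply; rewrite uE.
case: q_ideal => _ _ _; apply; last exact: A_in_q.
apply: (Aint_Qfield_Zring p_pr p_odd z_prim v_prim sigmaz) => //.
have -> : u = A^-1.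
  have A0 : A != 0 by apply: contraTneq (oner_neq0 algC) => A0; rewrite uE A0 mulr0 eqxx.
  by apply: (mulIf A0); rewrite -uE mulVf.
by apply: (Qfield_inv p_pr p_odd z_prim v_prim sigmaz); apply: Zring_Qfield.
Qed.

(* The ideal q extends to the principal ideal generated by a in the ring of
   all algebraic integers. *)
Let a := p.-root A.

Lemma a_exp : a ^+ p = A. Proof. exact: rootCK. Qed.

Lemma a_Aint : a \in Aint.
Proof. by apply: (Aint_root_exp p_gt0); rewrite a_exp A_Aint. Qed.

(** For x in q, x^p lies in q^p, generated by A = a^p; take p-th roots. *)
Lemma adv_a x : q x -> adv a x.
Proof.
move=> /(exp_ideal_pow z p) /A_qp[r [rR rE]].
apply: (adv_root p_gt0); rewrite a_exp rE mulrC.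
by exists r => //; apply: Zring_Aint rR.
Qed.

Lemma a_nonunit : ~ adv a 1.
Proof. by move/(advX p); rewrite a_exp expr1n; apply: A_nonunit. Qed.

Lemma lam_notin_q : ~ q lam.
Proof.
move=> ql; apply: a_nonunit; rewrite -[1](subKr A).
apply: advB; first exact/adv_a/A_in_q.
apply: adv_trans A_cong; rewrite exprS; apply: advMr; first by rewrite rpredX.
exact: adv_a.
Qed.

(** * The conjugates of [a] above the rational prime l *)

Variables (l : nat).
Hypotheses (l_pr : prime l) (l_q : q l%:R).
Hypothesis l_deg1 : forall x, Zring z x -> exists n : int, q (x - n%:~R).

Let l_gt1 := prime_gt1 l_pr.

Lemma adv_a_nat k : adv a k%:R -> (l %| k)%N.
Proof.
move=> ak; apply: contraT; rewrite -prime_coprime // => lk; case: a_nonunit.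
by apply: (adv_coprime lk) => //; [apply: prime_gt0 | apply: adv_a].
Qed.

Lemma adv_a_natB1 k : adv a (k%:R - 1) -> (k%:R : 'F_l) = 1.
Proof.
move=> ak; have : adv a (k + l.-1)%:R.
  have -> : (k + l.-1)%:R = (k%:R - 1) + l%:R :> algC.
    by rewrite -[in RHS](prednK (prime_gt0 l_pr)) -natr1 natrD; ring.
  by apply: advD => //; apply: adv_a.
move/adv_a_nat; rewrite -Fp_natr_eq0 // natrD addr_eq0 => /eqP->.
have : (1 + l.-1%:R : 'F_l) == 0.
  by rewrite addrC natr1 prednK ?prime_gt0 // Fp_natr_eq0.
by rewrite addr_eq0 => /eqP <-.
Qed.

(** If l were p, [a] would divide a power of [lam]; but A = a^p is 1 modulo [lam], so [a] and [lam]
    are comaximal. *)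
Lemma l_neq_p : l != p.
Proof.
apply/eqP => lp; apply: a_nonunit.
have al : adv a (lam ^+ p.-1).
  apply: adv_trans (adv_p_lam p_pr z_prim); rewrite -lp; exact: adv_a.
have [u uA uE] := A_cong.
have alam : acop a lam.
  exists (a ^+ p.-1), (- (u * lam ^+ 2)); split.
  - by rewrite rpredX // a_Aint.
  - by rewrite rpredN rpredM ?rpredX.
  - rewrite -exprSr prednK // a_exp mulNr -mulrA -exprSr -uE.
    by rewrite opprB addrC subrK.
have [u' [v' [uA' vA' <-]]] := acopX p.-1 a_Aint lamAint alam.
by apply: advD; apply: advMl => //; apply: advv.
Qed.

(** Inertial degree 1 gives the reduction r of z in F_l. Its order divides p, and r = 1 would put
    [lam] in q. *)
Lemma residue_root : exists2 r : 'F_l, p.-primitive_root r &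
  adv a (z - (r : nat)%:R).
Proof.
have [n nq] := l_deg1 (Zring_gen z).
pose n' := `|(n %% l)%Z|%N.
have n'E : n'%:Z = (n %% l)%Z by rewrite gez0_abs // modz_ge0 //; lia.
have al := adv_a l_q.
have az : adv a (z - n'%:R).
  have -> : z - n'%:R = (z - n%:~R) + (n %/ l)%Z%:~R * l%:R.
    rewrite {1}(divz_eq n l) rmorphD rmorphM /= -n'E.
    by rewrite -[(l%:Z)%:~R]/(l%:R) -[(n'%:Z)%:~R]/(n'%:R); ring.
  by apply: advD; [apply: adv_a | apply: advMl; rewrite ?Aint_int].
have n'l : (n' < l)%N by rewrite -ltz_nat n'E ltz_pmod //; lia.
pose r : 'F_l := n'%:R.
have rE : (r : nat) = n' by rewrite val_Fp_nat // modn_small.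
exists r; last by rewrite rE.
have rp : r ^+ p = 1.
  rewrite -natrX; apply: adv_a_natB1.
  have -> : (n' ^ p)%:R - 1 = - (z ^+ p - n'%:R ^+ p) :> algC.
    by rewrite (prim_expr_order z_prim) natrX opprB.
  by apply: advN; apply: adv_subX; rewrite ?rpred_nat.
have [k rk kp] := prim_order_exists p_gt0 rp.
case/primeP: p_pr => _ /(_ _ kp)/orP[/eqP k1|/eqP <- //].
case: lam_notin_q; have r1 : r = 1 by rewrite -[r]expr1 -k1 (prim_expr_order rk).
have n'1 : n' = 1%N.
  by rewrite -rE r1 /= modn_small // Fp_cast.
have -> : lam = (z - n%:~R) + (n %/ l)%Z%:~R * l%:R.
  rewrite {1}(divz_eq n l) rmorphD rmorphM /= -n'E n'1.
  by rewrite -[(l%:Z)%:~R]/(l%:R) -[(1%:Z)%:~R]/(1%:R) /lam; ring.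
case: q_ideal => _ _ qD qM; apply: qD => //; apply: qM => //; exact: Zring_int.
Qed.

Lemma iterm_a_Aint i : s i a \in Aint.
Proof. by rewrite Aint_rmorph // a_Aint. Qed.

Lemma adv_iterm_a i : adv (s i a) l%:R.
Proof. by rewrite -(rmorph_nat (s i)); apply/adv_rmorph/adv_a. Qed.

Lemma adv_iterm_a_root i n : adv a (z - n%:R) -> adv (s i a) (z ^+ (v ^ i) - n%:R).
Proof. by move/(adv_rmorph (s i)); rewrite rmorphB rmorph_nat (iterm_root sigmaz). Qed.

(* z ^+ (v ^ i) - z ^+ (v ^ j) divides p, which is prime to l. *)
Lemma acop_iterm_a i j : (i < p.-1)%N -> (j < p.-1)%N -> i != j ->
  acop (s i a) (s j a).
Proof.
move=> ip jp ij; have [r _ rz] := residue_root.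
have [ui uiA uiE] := adv_iterm_a_root i rz; have [uj ujA ujE] := adv_iterm_a_root j rz.
(* Modulo p this is v^i - v^j, with [p.-1] standing for -1 to stay among natural numbers. *)
pose k := (v ^ i + p.-1 * v ^ j)%N.
have pk : ~~ (p %| k)%N.
  apply: contra ij => pk; apply/eqP/(v_exp_inj p_pr p_odd z_prim v_prim ip jp).
  have kE : (k + v ^ j = v ^ j * p + v ^ i)%N.
    by rewrite /k -addnA -mulSnr prednK // mulnC addnC.
  by rewrite -[LHS](modnMDl (v ^ j)) -kE -modnDml (eqP pk) add0n.
have [t tA tE] := adv_trans (adv_z_lam p_pr z_prim pk) (adv_lam_p1 p_pr z_prim).
have zk : z ^+ k - 1 = z ^+ (v ^ j * p.-1) * (ui * s i a - uj * s j a).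
  rewrite -uiE -ujE opprB addrA subrK mulrBr -!exprD /k [(v ^ j * _)%N]mulnC.
  by rewrite [(p.-1 * _ + v ^ i)%N]addnC -mulSnr prednK // exprM (prim_expr_order z_prim) expr1n.
apply: (@acop_of_comb _ _ (t * z ^+ (v ^ j * p.-1) * ui)
  (- (t * z ^+ (v ^ j * p.-1) * uj)) p l) => //.
- by rewrite prime_coprime // dvdn_prime2 // eq_sym l_neq_p.
- by rewrite !rpredM ?rpredX.
- by rewrite rpredN !rpredM ?rpredX.
- by rewrite tE zk; ring.
- exact: adv_iterm_a.
Qed.

(** * The element A^P(sigma) and its p-th root *)

Lemma coprime_w : coprime w p.
Proof.
rewrite coprime_sym prime_coprime //; apply/negP => /dvdnP[k wE].
by move: vw; rewrite wE mulnA modnMl.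
Qed.

Lemma w_exp_bounds i : (0 < w ^ i %% p < p)%N.
Proof.
rewrite ltn_pmod // andbT lt0n -/(dvdn _ _) -prime_coprime //.
by rewrite coprime_sym coprimeXl // coprime_w.
Qed.

Lemma vw_exp i : (v ^ i * w ^ i = 1 %[mod p])%N.
Proof. by rewrite -expnMn -modnXm vw exp1n. Qed.

(** As v^((p-1)/2) is -1 modulo p, so is the same power of w; the sum is a multiple of p strictly
    between 0 and 2p. *)
Lemma w_exp_half i : (w ^ i %% p + w ^ (p./2 + i) %% p = p)%N.
Proof.
have /andP[a0 ap] := w_exp_bounds i.
have /andP[b0 bp] := w_exp_bounds (p./2 + i).
have : (p %| w ^ i %% p + w ^ (p./2 + i) %% p)%N.
  rewrite /dvdn modnDm expnD addnC -mulSnr -/(dvdn _ _); apply: dvdn_mulr.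
  rewrite -(@Gauss_dvdr _ (v ^ p./2)); last first.
    by rewrite coprime_sym coprimeXl // (coprime_v p_pr v_prim).
  rewrite mulnS /dvdn -modnDmr vw_exp modnDmr -modnDml.
  by rewrite (v_exp_half p_pr p_odd z_prim v_prim) modnDml addn1 prednK // modnn.
case/dvdnP => -[|[|k]]; rewrite ?mul0n ?mul1n //; first by move: a0; lia.
by rewrite !mulSn => E; move: ap bp; lia.
Qed.

Let b := \prod_(i < p.-1) s i a ^+ (w ^ i %% p).
Let B := \prod_(i < p.-1) s i A ^+ (w ^ i %% p).

Lemma b_exp : b ^+ p = B.
Proof.
rewrite -prodrXl; apply: eq_bigr => i _.
by rewrite exprAC -[in RHS]a_exp rmorphXn.
Qed.

Lemma acopXX x y m n : x \in Aint -> y \in Aint -> acop x y ->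
  acop (x ^+ m) (y ^+ n).
Proof.
move=> xA yA xy; apply: acopX => //; first by rewrite rpredX.
by apply/acopC/acopX => //; apply: acopC.
Qed.

Lemma adv_prod_iterm_a (f : nat -> nat) t : t \in Aint ->
  (forall i, adv (s i a ^+ f i) t) -> adv (\prod_(i < p.-1) s i a ^+ f i) t.
Proof.
move=> tA H; apply: acop_prod_adv => // [i|i j ij]; first by rewrite rpredX ?iterm_a_Aint.
by apply: acopXX; rewrite ?iterm_a_Aint //; apply: acop_iterm_a; rewrite ?ltn_ord.
Qed.

(** Apply sigma^i to the congruence of z with r, then raise to the power v^(-i): modulo the i-th
    conjugate of [a], z reduces to r^(v^(-i)). This is the exponent fed to Stickelberger. *)
Lemma adv_iterm_a_residue (r : 'F_l) i : adv a (z - (r : nat)%:R) ->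
  adv (s i a) (z - ((r ^+ (w ^ i %% p) : 'F_l) : nat)%:R).
Proof.
set k := (w ^ i %% p)%N => /(adv_iterm_a_root i) rz; pose n : nat := r.
have zE : z = (z ^+ (v ^ i)) ^+ k.
  by rewrite -exprM -(prim_expr_mod z_prim) modnMmr vw_exp modn_small ?expr1.
have nE : ((r ^+ k : 'F_l) : nat) = (n ^ k %% l)%N.
  by rewrite -val_Fp_nat // natrX natr_Zp.
have -> : z - ((r ^+ k : 'F_l) : nat)%:R =
    ((z ^+ (v ^ i)) ^+ k - n%:R ^+ k) + (n ^ k %/ l)%:R * l%:R.
  have E : (n ^ k)%:R = (n ^ k %/ l)%:R * l%:R + (n ^ k %% l)%:R :> algC.
    by rewrite -natrM -natrD -divn_eq.
  by rewrite nE -zE -natrX E; ring.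
apply: advD; first by apply: adv_subX; rewrite ?rpredX ?rpred_nat.
by apply: advMl; [rewrite rpred_nat | apply: adv_iterm_a].
Qed.

Lemma adv_b_gauss d (xi : algC) (r : 'F_l) : l.-1 = (p * d)%N ->
  l.-primitive_root xi -> p.-primitive_root r -> adv a (z - (r : nat)%:R) ->
  adv b (gauss d z xi r p_pr ^+ p).
Proof.
move=> ld xi_prim r_prim rz.
apply: (@adv_prod_iterm_a (fun i => w ^ i %% p)%N).
  by rewrite rpredX //; apply: gaussA.
move=> i; apply: (stickelberger _ l_pr ld z_prim xi_prim r_prim).
- exact: w_exp_bounds.
- exact: iterm_a_Aint.
- exact: adv_iterm_a.
- exact: adv_iterm_a_residue.
Qed.

Lemma A_Qfield : Qfield z A. Proof. exact: Zring_Qfield. Qed.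

(** Conjugation commutes with every s_i on Q(z), and the norm is rational, hence real. *)
Lemma gal_nm_conj_A : gal_nm p sigma A^* = gal_nm p sigma A.
Proof.
rewrite -[RHS](@Crat_rmorph Num.conj); last first.
  exact: (gal_nm_rat p_pr p_odd z_prim v_prim sigmaz A_Qfield).
rewrite /gal_nm rmorph_prod; apply: eq_bigr => i _ /=.
by rewrite (conj_iterm p_pr z_prim sigmaz) //; apply: A_Qfield.
Qed.

(* N(A) divides l^p, hence is l^k up to sign with 0 < k <= p, and N(D)^p = N(A)^2
   forces p to divide 2 k. *)
Lemma gal_nm_A_sqr : gal_nm p sigma A ^+ 2 = l%:R ^+ (2 * p).
Proof.
have [[DQ Dreal] DA] := DO.
have /intrP[t tE] := gal_nm_int p_pr p_odd z_prim v_prim sigmaz A_Qfield A_Aint.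
have /intrP[u uE] := gal_nm_int p_pr p_odd z_prim v_prim sigmaz DQ DA.
have ut : (`|u| ^ p = `|t| ^ 2)%N.
  apply/eqP; rewrite -!abszX -(eqr_nat algC) !natr_absz !intr_norm !rmorphXn /=.
  by rewrite -tE -uE -gal_nm_exp -AD gal_nm_mul gal_nm_conj_A expr2.
have tl : (`|t| %| l ^ p)%N.
  apply: (@adv_int _ (l ^ p)%N%:Z); change (adv `|t|%N%:R (l ^ p)%:R); rewrite natrX.
  (* The conjugates of [a] are pairwise comaximal divisors of l, so their product divides l; then
     take p-th powers. *)
  have : adv (gal_nm p sigma a ^+ p) (l%:R ^+ p).
    apply: advX; rewrite /gal_nm; under eq_bigr do rewrite -[s _ a]expr1.
    apply: (adv_prod_iterm_a (f := fun=> 1%N)); first by rewrite rpred_nat.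
    by move=> i; rewrite expr1; apply: adv_iterm_a.
  rewrite -gal_nm_exp a_exp tE.
  rewrite {1}[t]intEsign rmorphM rmorph_sign => -[c cA cE].
  exists (c * (-1) ^+ (t < 0)%R); first by rewrite rpredM // rpredX // rpredN rpred1.
  by rewrite cE mulrA.
have [k kp kE] := dvdn_pfactor _ _ l_pr tl.
have k0 : (0 < k)%N.
  rewrite lt0n; apply/eqP => k0; apply: A_nonunit.
  have t1 : adv (t%:~R) 1.
    exists t%:~R; first exact: Aint_int.
    have : t = 1 \/ t = -1 by move: kE; rewrite k0 expn0; clear; lia.
    by case=> ->; rewrite ?rmorphN rmorph1 ?mulrNN mulr1.
  apply: adv_trans t1; rewrite -tE /gal_nm.
  have p2 : (0 < p.-1)%N by rewrite -subn1 subn_gt0.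
  apply: (adv_prod_factor (i := Ordinal p2)) => // i; by rewrite Aint_rmorph ?A_Aint.
have : (p %| 2 * k)%N.
  have := congr1 (logn l) ut; rewrite kE -expnM lognX pfactorK //.
  by move=> E; rewrite mulnC -E dvdn_mulr.
rewrite Gauss_dvdr; last by rewrite coprimen2.
move=> /(dvdn_leq k0) pk; have kpE : k = p by apply/eqP; rewrite eqn_leq kp pk.
have -> : gal_nm p sigma A ^+ 2 = (l ^ p)%:R ^+ 2.
  have -> : (l ^ p = `|t|)%N by rewrite kE kpE.
  by rewrite tE natr_absz intr_norm real_normK ?realz.
by rewrite natrX -exprM mulnC.
Qed.

Lemma prod_halves (F : nat -> algC) :
  \prod_(i < p.-1) F i = \prod_(i < p./2) (F i * F (p./2 + i)%N).
Proof.
have hE : p.-1 = (p./2 + p./2)%N by have := odd_double_half p; lia.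
rewrite -(big_mkord xpredT) hE big_mkord big_split_ord /= -big_split.
by [].
Qed.

Lemma B_Zring : Zring z B.
Proof.
by apply: Zring_prod => i _; apply: ZringX; apply: (iterm_Zring sigmaz).
Qed.

(* Complex conjugation is s p./2, and the exponents w ^ i and w ^ (p./2 + i)
   add up to p; so the square of B * B^* is a power of the norm of A. *)
Lemma norm_B : B * B^* = l%:R ^+ (p * p).
Proof.
pose C := A * A^*.
have CQ : Qfield z C.
  by apply: QfieldM; [apply: A_Qfield | apply: (conj_Qfield p_pr z_prim A_Qfield)].
have Creal : C^* = C by rewrite /C rmorphM /= conjCK; apply: mulrC.
have sC i : s (p./2 + i) C = s i C.
  rewrite itermD (iterm_half p_pr p_odd z_prim v_prim sigmaz); last first.
    exact: (iterm_Qfield sigmaz).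
  by rewrite (conj_iterm p_pr z_prim sigmaz) // Creal.
have BE : B * B^* = \prod_(i < p./2) s i C ^+ p.
  have -> : B * B^* = \prod_(i < p.-1) s i C ^+ (w ^ i %% p).
    rewrite /B rmorph_prod -big_split; apply: eq_bigr => i _ /=.
    rewrite rmorphXn /= (conj_iterm p_pr z_prim sigmaz); last exact: A_Qfield.
    by rewrite -exprMn -rmorphM.
  rewrite (prod_halves (fun i => s i C ^+ (w ^ i %% p))).
  by apply: eq_bigr => i _; rewrite sC -exprD w_exp_half.
have nmC : gal_nm p sigma C = l%:R ^+ (2 * p).
  by rewrite gal_nm_mul gal_nm_conj_A -expr2 gal_nm_A_sqr.
have B2 : (B * B^*) ^+ 2 = (l%:R ^+ (p * p)) ^+ 2.
  rewrite -exprM [(p * p * 2)%N]mulnC mulnA exprM -nmC.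
  rewrite /gal_nm (prod_halves (fun i => s i C)) BE -!prodrXl.
  by apply: eq_bigr => i _; rewrite sC -expr2 exprAC.
apply/eqP; rewrite -(@eqrXn2 _ 2) ?B2 //; first by rewrite mul_conjC_ge0.
by rewrite exprn_ge0 // ler0n.
Qed.

Lemma iterm_A_cong i : adv (lam ^+ 2) (s i A - 1).
Proof.
have := adv_rmorph (s i) A_cong; rewrite rmorphXn !rmorphB !rmorph1 (iterm_root sigmaz).
apply: adv_trans; apply: (@adv_trans (lam ^+ 3)); first exact: adv_exp_le.
exact/advX/(adv_lam_z z_prim).
Qed.

Lemma B_cong : adv (lam ^+ 2) (B - 1).
Proof.
suff [] : B \in Aint /\ adv (lam ^+ 2) (B - 1) by [].
apply: (big_ind (fun x => x \in Aint /\ adv (lam ^+ 2) (x - 1))).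
- by rewrite rpred1 subrr; split=> //; apply: adv0.
- move=> x y [xA xc] [yA yc]; rewrite rpredM //; split=> //.
  by rewrite -[X in _ - X]mulr1; apply: adv_subM; rewrite ?rpred1.
- move=> i _; rewrite rpredX ?Aint_rmorph ?A_Aint //; split=> //.
  rewrite -(expr1n _ (w ^ i %% p)).
  by apply: adv_subX; rewrite ?rpred1 ?Aint_rmorph ?A_Aint //; apply: iterm_A_cong.
Qed.

Lemma B_cong_gauss d (xi : algC) (r : 'F_l) : l.-1 = (p * d)%N ->
  l.-primitive_root xi -> p.-primitive_root r -> adv a (z - (r : nat)%:R) ->
  adv (lam ^+ (2 * (p - 1))) (B - 1).
Proof.
move=> ld xi_prim r_prim rz.
have [ple plt] : (2 <= p + p.-1)%N /\ (2 * (p - 1) <= p + p.-1)%N.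
  by move: p_gt1; clear; lia.
pose g := gauss d z xi r p_pr; pose h := (- g) ^+ p.
have hE : h = - (g ^+ p) by rewrite /h exprNn -signr_odd p_odd expr1 mulN1r.
have B0 : B != 0.
  apply: contraTneq (oner_neq0 algC) => B0.
  have /eqP := norm_B; rewrite B0 mul0r eq_sym expf_eq0 pnatr_eq0.
  by rewrite (gtn_eqF (prime_gt0 l_pr)) andbF.
(* From - tau = 1 modulo [lam], two p-th powers raise the exponent first to p and then to 2p - 1. *)
have hc : adv (lam ^+ p) (h - 1).
  have := @adv_lam_frob p z p_pr z_prim (- g) 1 isT.
  rewrite add1n prednK // expr1; apply.
  by rewrite -opprD; apply/advN; apply: gauss_cong l_pr ld z_prim xi_prim r_prim.
have hpc := @adv_lam_frob p z p_pr z_prim _ _ p_gt0 hc.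
pose eta := h ^+ p / B.
have etaB : eta * B = h ^+ p by rewrite divfK.
have etaA : eta \in Aint.
  (* [b] divides tau^p with quotient u, and b^p = B, so eta is (-u)^p. *)
  have [u uA uE] := adv_b_gauss ld xi_prim r_prim rz.
  have -> : eta = (- u) ^+ p.
    apply: (mulIf B0); rewrite etaB -b_exp -exprMn hE mulNr -uE.
    by [].
  by rewrite rpredX ?rpredN.
have etaQ : Qfield z eta.
  apply: QfieldM; last first.
    apply: (Qfield_inv p_pr p_odd z_prim v_prim sigmaz).
    exact/Zring_Qfield/B_Zring.
  apply: QfieldX; rewrite hE -sub0r; apply: QfieldB.
    by apply: Qfield_Crat; rewrite rpred0.
  exact: gauss_exp_Qfield l_pr ld z_prim xi_prim r_prim.
(* Each conjugate of tau has squared absolute value l, so that of h^p is l^(p p), the same as for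
   B. *)
have eta_norm i : `|s i eta| = 1.
  have sB : `|s i B| ^+ 2 = l%:R ^+ (p * p).
    rewrite normCK (conj_iterm p_pr z_prim sigmaz); last exact/Zring_Qfield/B_Zring.
    by rewrite -rmorphM norm_B rmorphXn rmorph_nat.
  apply/eqP; rewrite -(@pexpr_eq1 _ _ 2) //; apply/eqP.
  rewrite rmorphM fmorphV !rmorphXn rmorphN normrM normfV !normrX normrN.
  rewrite exprMn exprVn sB -!exprM mulnC exprM.
  rewrite (@gauss_norm p l d z xi r p_pr l_pr ld z_prim xi_prim r_prim) divff //.
  by rewrite expf_neq0 // pnatr_eq0 -lt0n prime_gt0.
have etac : adv (lam ^+ 2) (eta - 1).
  have -> : eta - 1 = (h ^+ p - 1) - eta * (B - 1) by rewrite -etaB; ring.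
  apply: advB; last by apply: advMl => //; apply: B_cong.
  by apply: adv_trans hpc; apply: adv_exp_le.
have eta1 := unit_circle_eq1 p_pr p_odd z_prim v_prim sigmaz etaQ etaA eta_norm etac.
rewrite -[B]mul1r -{1}eta1 etaB; apply: adv_trans hpc; exact: adv_exp_le.
Qed.

Lemma B_cong_pi : cong_pi z (2 * (p - 1)) B 1.
Proof.
have [r r_prim rz] := residue_root.
have [xi xi_prim] := C_prim_root_exists (prime_gt0 l_pr).
(* F_l contains the element r of order p, so p divides l - 1; this supplies d. *)
have /dvdnP[d ld] : (p %| l.-1)%N.
  rewrite (prim_order_dvd r_prim) Fp_exp_pred //.
  apply: contraTneq (oner_neq0 'F_l) => r0.
  by rewrite -(prim_expr_order r_prim) r0 expr0n gtn_eqF // eqxx.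
rewrite mulnC in ld.
apply: (adv_lam_cong p_pr p_odd z_prim v_prim sigmaz).
- exact/Zring_Qfield/B_Zring.
- exact: Qfield1.
- exact: B_cong_gauss ld xi_prim r_prim rz.
Qed.

End Main.

Theorem mainTheorem9
  (p : nat) (z : algC) (v w m : nat)
  (sigma : {rmorphism algC -> algC})
  (G : cset -> Prop) (q : cset) (A alpha D : algC) :
  prime p -> odd p ->
  p.-primitive_root z ->
  (* p irregular, p does not divide h(K_p^+) *)
  (exists h, class_number (Zring z) h /\ (p %| h)%N) ->
  (exists h, class_number (Oplus z) h /\ ~~ (p %| h)%N) ->
  (* primitive root v mod p, w its inverse mod p *)
  (0 < v < p)%N -> primitive_root_mod p v ->
  (0 < w < p)%N -> (v * w %% p = 1)%N ->
  (* sigma : zeta -> zeta^v *)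
  sigma z = z ^+ v ->
  (1 <= m)%N -> (m <= (p - 3) %/ 2)%N ->
  class_subgroup_order_p_annihilated (Zring z) p sigma (v ^ (2 * m + 1) %% p) G ->
  prime_ideal (Zring z) q -> inertial_degree_one (Zring z) q ->
  ~ is_principal (Zring z) q -> G q ->
  Zring z A ->
  seteq (principal (Zring z) A) (ideal_pow (Zring z) q p) ->
  Qfield z alpha ->
  sigma A = A ^+ (v ^ (2 * m + 1) %% p) * alpha ^+ p ->
  cong_pi z (2 * m + 1) A 1 -> ~ cong_pi z (2 * m + 2) A 1 ->
  Oplus z D -> A * A^* = D ^+ p ->
  cong_pi z (2 * (p - 1))
    (\prod_(i < p.-1) (iter i sigma A) ^+ (w ^ i %% p)) 1.
Proof.
move=> p_pr p_odd z_prim _ _ _ v_prim _ vw sigmaz m1 _ _ q_prime.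
move=> [l [l_pr l_q l_deg1]] _ _ AR A_qp _ _ A_cong _ DO AD.
under eq_bigr do rewrite -itermE.
apply: (B_cong_pi p_pr p_odd z_prim v_prim vw sigmaz q_prime AR A_qp _ DO AD
  l_pr l_q l_deg1).
(* The exponent 3 comes from 2m + 1 with m at least 1. *)
apply: adv_trans (cong_pi_adv z_prim A_cong).
by apply: adv_exp_le; [apply: lamA z_prim | lia].
Qed.
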